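(* Let $F$ be a field of characteristic zero. Every automorphism of the two generated free brace algebra $Br(x_1,x_2)$ over $F$ is tame.
   Context: A brace algebra over $F$ is an $F$-vector space $A$ with a family of multilinear operations $A^{\otimes n}\to A$, $a_n\otimes\dots\otimes a_1\mapsto\langle a_n,\dots,a_2;a_1\rangle$, for all $n\ge 2$ (with the convention $\langle a\rangle=a$), such that for all $a_1,\dots,a_m,b_1,\dots,b_n,c\in A$: $$\langle a_m,\dots,a_1;\langle b_n,\dots,b_1;c\rangle\rangle=\sum\langle V_{2n},\langle V_{2n-1};b_n\rangle,\dots,V_4,\langle V_3;b_2\rangle,V_2,\langle V_1;b_1\rangle,V_0;c\rangle,$$ the sum running over all partitions of the ordered set $\{a_m,\dots,a_1\}$ into (possibly empty) consecutive intervals $V_{2n}\sqcup\dots\sqcup V_0$ (in this order). $Br(X)=Br(x_1,\dots,x_M)$ denotes the free brace algebra over $F$ generated by $X=\{x_1,\dots,x_M\}$. Concretely, normal brace words on $X$ are defined recursively: each letter $x\in X$ is a normal brace word, and if $x\in X$ and $u_1,\dots,u_n$ ($n\ge1$) are normal brace words, then $\langle u_n,\dots,u_1;x\rangle$ is a normal brace word. The set of normal brace words is an $F$-basis of $Br(X)$, and the operations are the multilinear ones determined recursively by: $\langle v_m,\dots,v_1;x\rangle$ is the normal brace word itself for $x\in X$, and, for $w=\langle u_n,\dots,u_1;x\rangle$, $\langle v_m,\dots,v_1;w\rangle=\sum\langle V_{2n},\langle V_{2n-1};u_n\rangle,\dots,V_2,\langle V_1;u_1\rangle,V_0;x\rangle$,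 the sum over partitions of $\{v_m,\dots,v_1\}$ into possibly empty consecutive intervals $V_{2n}\sqcup\dots\sqcup V_0$. An automorphism $\phi$ of $Br(x_1,\dots,x_M)$ is elementary if for some $i$ one has $\phi(x_j)=x_j$ for all $j\ne i$ and $\phi(x_i)=\alpha x_i+f$ with $0\neq\alpha\in F$ and $f\in Br(x_1,\dots,x_{i-1},x_{i+1},\dots,x_M)$. An automorphism is tame if it can be expressed as a composition of elementary automorphisms. *)

(* Defs.v *)
From HB Require Import structures.
From mathcomp Require Import all_boot all_order all_algebra finmap.
From mathcomp Require Import monalg.

Set Implicit Arguments.
Unset Strict Implicit.
Unset Printing Implicit Defensive.

Import GRing.Theory.
Local Open Scope ring_scope.

(* The pairs (p, q) with s = p ++ q, one for each of the size s + 1 cuts of s. *)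
Fixpoint cuts (T : Type) (s : seq T) : seq (seq T * seq T) :=
  if s is x :: s' then
    ([::], s) :: [seq (x :: p.1, p.2) | p <- cuts s']
  else [:: ([::], [::])].

(* For us = [:: u_n; ...; u_1], the list (with multiplicity) of the sequences
     V_2n ++ t_n :: V_(2n-2) ++ ... ++ V_2 ++ t_1 :: V_0,
   where V = V_2n ++ V_(2n-1) ++ ... ++ V_0 ranges over the cuttings of V into
   2n+1 consecutive, possibly empty, intervals and t_i ranges over
   br V_(2i-1) u_i. The operation br is list valued because the brace of basis
   words is a sum of words; a genuine brace operation is inserted through
   singletons. *)
Section Insertions.
Variables (T : Type) (br : seq T -> T -> seq T).

Fixpoint insertions (us V : seq T) : seq (seq T) :=
  if us is u :: us' then
    flatten [seq flatten [seq [seq p.1 ++ t :: r | t <- br q.1 u,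
                                                   r <- insertions us' q.2]
                         | q <- cuts p.2]
            | p <- cuts V]
  else [:: V].

End Insertions.

(* The brace <a_n, ..., a_2; a_1> is brace [:: a_n; ...; a_2] a_1. *)
HB.mixin Record Lmodule_isBraceAlgebra (F : fieldType) A
    of GRing.Lmodule F A := {
  brace : seq A -> A -> A;
  brace_nil : forall a, brace [::] a = a;
  brace_linearl : forall (s1 s2 : seq A) (a : A),
    linear (fun v => brace (s1 ++ v :: s2) a);
  brace_linearr : forall s : seq A, linear (brace s);
  brace_brace : forall (a b : seq A) (c : A),
    brace a (brace b c) =
      \sum_(s <- insertions (fun v u => [:: brace v u]) b a) brace s c
}.

#[short(type="braceAlgType")]
HB.structure Definition BraceAlgebra (F : fieldType) :=
  {A of Lmodule_isBraceAlgebra F A & GRing.Lmodule F A}.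

Definition brace_morphism (F : fieldType) (A B : braceAlgType F)
    (phi : A -> B) : Prop :=
  linear phi /\
  (forall (s : seq A) (a : A), phi (brace s a) = brace (map phi s) (phi a)).

Definition brace_automorphism (F : fieldType) (A : braceAlgType F)
    (phi : A -> A) : Prop :=
  brace_morphism phi /\ bijective phi.

(* Normal brace words on M letters: BWord x [:: u_n; ...; u_1] stands for
   <u_n, ..., u_1; x>, and BWord x [::] for the letter x. *)
Inductive bword (M : nat) : Type := BWord of 'I_M & seq (bword M).

Section WordChoice.
Variable M : nat.

Fixpoint bword_tree (w : bword M) : GenTree.tree 'I_M :=
  let: BWord x us := w in
  GenTree.Node 0 (GenTree.Leaf x :: map bword_tree us).

Fixpoint tree_bword (t : GenTree.tree 'I_M) : option (bword M) :=
  if t is GenTree.Node _ (GenTree.Leaf x :: ts) then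
    Some (BWord x (pmap tree_bword ts))
  else None.

Lemma bword_treeK : pcancel bword_tree tree_bword.
Proof.
rewrite /pcancel; fix IH 1 => -[x us] /=; congr (Some (BWord x _)).
by elim: us => //= u us IHus; rewrite IH /= IHus.
Qed.

HB.instance Definition _ := Countable.copy (bword M) (pcan_type bword_treeK).

Lemma bword_eq_ind (P : bword M -> Prop) :
  (forall x us, {in us, forall u, P u} -> P (BWord x us)) -> forall w, P w.
Proof.
move=> H; fix IH 1 => -[x us]; apply: H.
elim: us => [{IH}|u us IHus] v; [by rewrite in_nil | rewrite inE].
by case: (v =P u) => [-> _|_]; [apply: IH | apply: IHus].
Qed.

End WordChoice.

(* The words occurring, with multiplicity, in <v_m, ..., v_1; w>. *)
Fixpoint bword_brace (M : nat) (V : seq (bword M)) (w : bword M) {struct w} :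
    seq (bword M) :=
  let: BWord x us := w in
  map (BWord x) (insertions (@bword_brace M) us V).

Fixpoint letters (M : nat) (w : bword M) : seq 'I_M :=
  let: BWord x us := w in x :: flatten (map (@letters M) us).

Definition Br (F : fieldType) (M : nat) : Type := {malg F[bword M]}.
HB.instance Definition _ (F : fieldType) (M : nat) :=
  GRing.Lmodule.copy (Br F M) {malg F[bword M]}.

Section Extension.
Variables (F : fieldType) (M : nat).

Definition word (w : bword M) : Br F M := << w >>.
Definition gen (i : 'I_M) : Br F M := word (BWord i [::]).

Variable A : lmodType F.

Definition lin_ext (g : bword M -> A) (v : Br F M) : A :=
  \sum_(u <- msupp v) v@_u *: g u.

(* The multilinear extension of a function of finite sequences of words. *)
Fixpoint multilin_ext (g : seq (bword M) -> A) (vs : seq (Br F M)) : A :=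
  if vs is v :: vs' then
    lin_ext (fun u => multilin_ext (fun us => g (u :: us)) vs') v
  else g [::].

End Extension.

Definition Br_brace (F : fieldType) (M : nat) (vs : seq (Br F M)) (w : Br F M) :
    Br F M :=
  multilin_ext
    (fun us => lin_ext (fun u => \sum_(t <- bword_brace us u) word F t) w) vs.

Section InsertionSums.
Variables (T : Type) (Z : zmodType).
Implicit Types (V : seq T).

Lemma sum_insertions_cons (br : seq T -> T -> seq T) u us V (g : seq T -> Z) :
  \sum_(s <- insertions br (u :: us) V) g s =
  \sum_(p <- cuts V) \sum_(q <- cuts p.2) \sum_(t <- br q.1 u)
    \sum_(r <- insertions br us q.2) g (p.1 ++ t :: r).
Proof.
rewrite /= big_flatten big_map; apply: eq_bigr => p _.
rewrite big_flatten big_map; apply: eq_bigr => q _.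
by rewrite big_flatten big_map; apply: eq_bigr => t _; rewrite big_map.
Qed.

Lemma sum_cuts_cons x V (g : seq T * seq T -> Z) :
  \sum_(p <- cuts (x :: V)) g p =
  g ([::], x :: V) + \sum_(p <- cuts V) g (x :: p.1, p.2).
Proof. by rewrite /= big_cons big_map. Qed.

Lemma sum_cuts_assoc V (g : seq T -> seq T -> seq T -> Z) :
  \sum_(p <- cuts V) \sum_(q <- cuts p.2) g p.1 q.1 q.2 =
  \sum_(p <- cuts V) \sum_(q <- cuts p.1) g q.1 q.2 p.2.
Proof.
elim: V g => [|x V IH] g; first by rewrite /= !(big_seq1, big_cons, big_nil) /=.
rewrite !sum_cuts_cons /= big_seq1 /= -addrA; congr (_ + _).
rewrite (IH (fun a b c => g (x :: a) b c)) -big_split /=.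
by apply: eq_bigr => p _; rewrite big_cons big_map.
Qed.

Lemma sum_cuts_cat V1 x V2 (g : seq T -> seq T -> Z) :
  \sum_(p <- cuts (V1 ++ x :: V2)) g p.1 p.2 =
  \sum_(p <- cuts V1) g p.1 (p.2 ++ x :: V2) +
  \sum_(p <- cuts V2) g (V1 ++ x :: p.1) p.2.
Proof.
elim: V1 g => [|y V1 IH] g.
  by rewrite sum_cuts_cons /= big_seq1.
by rewrite cat_cons !sum_cuts_cons /= (IH (fun a b => g (y :: a) b)) addrA.
Qed.

Variable br : seq T -> T -> seq T.

Lemma sum_insertions_cat b1 t b2 V (g : seq T -> Z) :
  \sum_(s <- insertions br (b1 ++ t :: b2) V) g s =
  \sum_(p <- cuts V) \sum_(q <- cuts p.2)
    \sum_(s1 <- insertions br b1 p.1) \sum_(y <- br q.1 t)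
    \sum_(s2 <- insertions br b2 q.2) g (s1 ++ y :: s2).
Proof.
elim: b1 V g => [|b b1 IH] V g.
  rewrite cat0s sum_insertions_cons; apply: eq_bigr => p _.
  by apply: eq_bigr => q _; rewrite big_seq1.
rewrite cat_cons sum_insertions_cons.
pose h a b0 c d e := \sum_(z <- br b0 b) \sum_(s1 <- insertions br b1 c)
   \sum_(y <- br d t) \sum_(s2 <- insertions br b2 e)
   g (a ++ z :: s1 ++ y :: s2).
transitivity (\sum_(p <- cuts V) \sum_(q <- cuts p.2) \sum_(p' <- cuts q.2)
    \sum_(q' <- cuts p'.2) h p.1 q.1 p'.1 q'.1 q'.2).
  apply: eq_bigr => p _; apply: eq_bigr => q _.
  under eq_bigr => z _ do rewrite (IH q.2 (fun s => g (p.1 ++ z :: s))).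
  rewrite exchange_big; apply: eq_bigr => p' _.
  by rewrite exchange_big.
transitivity (\sum_(p <- cuts V) \sum_(q <- cuts p.2) \sum_(p1 <- cuts p.1)
   \sum_(p2 <- cuts p1.2) h p1.1 p2.1 p2.2 q.1 q.2); last first.
  apply: eq_bigr => p _; apply: eq_bigr => q _.
  rewrite sum_insertions_cons; apply: eq_bigr => p1 _; apply: eq_bigr => p2 _.
  apply: eq_bigr => z _; apply: eq_bigr => s1 _; apply: eq_bigr => y _.
  by apply: eq_bigr => s2 _; rewrite -catA.
under eq_bigr => p _ do
  rewrite (sum_cuts_assoc p.2 (fun b0 c d => \sum_(q' <- cuts d)
              h p.1 b0 c q'.1 q'.2)).
rewrite (sum_cuts_assoc V (fun a bc d => \sum_(q <- cuts bc)
   \sum_(q' <- cuts d) h a q.1 q.2 q'.1 q'.2)).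
apply: eq_bigr => p _; rewrite [RHS]exchange_big; apply: eq_bigr => p1 _.
by rewrite exchange_big.
Qed.

Lemma sum_cuts_insertions us V (g : seq T -> seq T -> Z) :
  \sum_(s <- insertions br us V) \sum_(p <- cuts s) g p.1 p.2 =
  \sum_(p <- cuts V) \sum_(q <- cuts us)
    \sum_(s1 <- insertions br q.1 p.1) \sum_(s2 <- insertions br q.2 p.2)
      g s1 s2.
Proof.
elim: us V g => [|u us IH] V g.
  by rewrite big_seq1; apply: eq_bigr => p _; rewrite /= !big_seq1.
rewrite sum_insertions_cons.
under [RHS]eq_bigr => p _ do
  (rewrite sum_cuts_cons big_seq1; under [X in _ + X]eq_bigr => q _ do
     rewrite sum_insertions_cons).
rewrite [RHS]big_split /=.
under eq_bigr => p _ do under eq_bigr => q _ do under eq_bigr => t _ do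
  (under eq_bigr => r _ do rewrite sum_cuts_cat; rewrite big_split /=).
under eq_bigr => p _ do under eq_bigr => q _ do rewrite big_split /=.
under eq_bigr => p _ do rewrite big_split /=.
rewrite big_split /=; congr (_ + _).
  under [RHS]eq_bigr => p _ do rewrite sum_insertions_cons.
  rewrite (sum_cuts_assoc V (fun V1 A p2 => \sum_(q <- cuts p2)
   \sum_(t <- br q.1 u) \sum_(r <- insertions br us q.2) g V1 (A ++ t :: r))).
  apply: eq_bigr => p _; rewrite [RHS]exchange_big; apply: eq_bigr => q _.
  rewrite [RHS]exchange_big; apply: eq_bigr => t _.
  by rewrite [RHS]exchange_big.
pose h a b c d := \sum_(t <- br b u) \sum_(q <- cuts us)
  \sum_(s1 <- insertions br q.1 c) \sum_(s2 <- insertions br q.2 d)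
  g (a ++ t :: s1) s2.
transitivity (\sum_(p <- cuts V) \sum_(q <- cuts p.2) \sum_(p' <- cuts q.2)
    h p.1 q.1 p'.1 p'.2).
  apply: eq_bigr => p _; apply: eq_bigr => q _; rewrite [RHS]exchange_big.
  by apply: eq_bigr => t _; rewrite (IH q.2 (fun a b => g (p.1 ++ t :: a) b)).
transitivity (\sum_(p <- cuts V) \sum_(p1 <- cuts p.1) \sum_(p2 <- cuts p1.2)
   h p1.1 p2.1 p2.2 p.2); last first.
  apply: eq_bigr => p _; rewrite [RHS]exchange_big; apply: eq_bigr => p1 _.
  rewrite [RHS]exchange_big; apply: eq_bigr => p2 _; rewrite exchange_big.
  by apply: eq_bigr => q _; apply: eq_bigr => t _; apply: eq_bigr => s1 _.
under eq_bigr => p _ do rewrite (sum_cuts_assoc p.2 (h p.1)).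
by rewrite (sum_cuts_assoc V (fun a bc d => \sum_(q <- cuts bc) h a q.1 q.2 d)).
Qed.

End InsertionSums.

Section WordIdentity.
Variables (M : nat) (Z : zmodType).

Lemma sum_bword_brace V x us (g : bword M -> Z) :
  \sum_(s <- bword_brace V (BWord x us)) g s =
  \sum_(s <- insertions (@bword_brace M) us V) g (BWord x s).
Proof. by rewrite big_map. Qed.

Lemma sum_bword_brace_brace V bs (c : bword M) (g : bword M -> Z) :
  \sum_(t <- bword_brace bs c) \sum_(s <- bword_brace V t) g s =
  \sum_(B <- insertions (@bword_brace M) bs V) \sum_(s <- bword_brace B c) g s.
Proof.
elim/bword_eq_ind: c V bs g => x us IH V bs g; rewrite sum_bword_brace.
under eq_bigr do rewrite sum_bword_brace.
under [RHS]eq_bigr do rewrite sum_bword_brace.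
suff {g} forestP (g : seq (bword M) -> Z) :
    \sum_(R <- insertions (@bword_brace M) us bs)
      \sum_(S <- insertions (@bword_brace M) R V) g S =
    \sum_(B <- insertions (@bword_brace M) bs V)
      \sum_(S <- insertions (@bword_brace M) us B) g S.
  exact: (forestP (fun s => g (BWord x s))).
elim: us IH V bs g => [|u us IHus] IH V bs g.
  by rewrite big_seq1; apply: eq_bigr => B _; rewrite big_seq1.
have {}IHus := IHus (fun v us_v => IH v (mem_behead (s := u :: us) us_v)).
have {}IH := IH u (mem_head u us).
set ins := insertions (@bword_brace M).
transitivity (\sum_(p <- cuts V) \sum_(q <- cuts bs) \sum_(p' <- cuts p.2)
  \sum_(q' <- cuts q.2) \sum_(s1 <- ins q.1 p.1)
  \sum_(y <- bword_brace q'.1 u) \sum_(r <- ins us q'.2)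
  \sum_(t <- bword_brace p'.1 y) \sum_(s2 <- ins r p'.2) g (s1 ++ t :: s2)).
  rewrite sum_insertions_cons /= [RHS]exchange_big /=; apply: eq_bigr => q _.
  under eq_bigr => q' _ do under eq_bigr => y _ do under eq_bigr => r _ do
    rewrite /= sum_insertions_cat.
  under [RHS]eq_bigr => p _ do rewrite exchange_big.
  rewrite [RHS]exchange_big; apply: eq_bigr => q' _.
  under eq_bigr => y _ do rewrite exchange_big.
  rewrite exchange_big; apply: eq_bigr => p _.
  under eq_bigr => y _ do rewrite exchange_big.
  rewrite exchange_big; apply: eq_bigr => p' _.
  under eq_bigr => y _ do rewrite exchange_big.
  by rewrite exchange_big.
under [RHS]eq_bigr => B _ do rewrite sum_insertions_cons.
rewrite (sum_cuts_insertions (@bword_brace M) bs V (fun B1 B' =>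
  \sum_(q <- cuts B') \sum_(t <- bword_brace q.1 u)
  \sum_(r <- insertions (@bword_brace M) us q.2) g (B1 ++ t :: r))) /=.
apply: eq_bigr => p _; apply: eq_bigr => q _.
under [RHS]eq_bigr => s1 _ do
  rewrite (sum_cuts_insertions (@bword_brace M) q.2 p.2 (fun B1 B' =>
    \sum_(t <- bword_brace B1 u)
    \sum_(r <- insertions (@bword_brace M) us B') g (s1 ++ t :: r))) /=.
rewrite [RHS]exchange_big; apply: eq_bigr => p' _.
rewrite [RHS]exchange_big; apply: eq_bigr => q' _.
apply: eq_bigr => s1 _.
under [RHS]eq_bigr do rewrite exchange_big.
rewrite -(IH p'.1 q'.1 (fun t => \sum_(s3 <- insertions (@bword_brace M) q'.2 p'.2)
   \sum_(r <- insertions (@bword_brace M) us s3) g (s1 ++ t :: r))).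
apply: eq_bigr => y _; rewrite exchange_big; apply: eq_bigr => t _.
exact: IHus.
Qed.

End WordIdentity.

Section ExtensionTheory.
Variables (F : fieldType) (M : nat).
Local Notation W := (bword M).
Local Notation B := (Br F M).

Section Codomain.
Variable A : lmodType F.
Implicit Types (g : W -> A) (G : seq W -> A).

Lemma lin_ext_fset (d : {fset W}) g (v : B) :
  (msupp v `<=` d)%fset -> lin_ext g v = \sum_(u <- d) v@_u *: g u.
Proof.
move=> le_d; rewrite /lin_ext (big_fset_incl _ le_d) // => u _ ?.
by rewrite mcoeff_outdom // scale0r.
Qed.

Lemma lin_ext_linear g : linear (@lin_ext F M A g).
Proof.
move=> a u v; pose d := (msupp u `|` msupp v)%fset.
rewrite (@lin_ext_fset d _ (a *: u + v)); last first.
  apply: fsubset_trans (msuppD_le _ _) _.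
  by apply: fsetUSS => //; apply: msuppZ_le.
rewrite (@lin_ext_fset d _ u) ?fsubsetUl // (@lin_ext_fset d _ v) ?fsubsetUr //.
rewrite scaler_sumr -big_split; apply: eq_bigr => w _ /=.
by rewrite mcoeffD mcoeffZ scalerDl scalerA.
Qed.

Lemma lin_ext_word g w : lin_ext g (word F w) = g w.
Proof.
rewrite /lin_ext /word msuppU oner_eq0 big_seq_fset1 mcoeffUU.
by rewrite scale1r.
Qed.

Lemma eq_lin_ext g1 g2 (v : B) :
  (forall u, g1 u = g2 u) -> lin_ext g1 v = lin_ext g2 v.
Proof. by move=> eq_g; apply: eq_bigr => u _; rewrite eq_g. Qed.

Lemma lin_ext_sum I (r : seq I) (g : I -> W -> A) (v : B) :
  lin_ext (fun u => \sum_(i <- r) g i u) v = \sum_(i <- r) lin_ext (g i) v.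
Proof.
rewrite /lin_ext exchange_big; apply: eq_bigr => u _.
by rewrite scaler_sumr.
Qed.

Lemma lin_ext_exchange (g : W -> W -> A) (u v : B) :
  lin_ext (fun a => lin_ext (g a) v) u =
  lin_ext (fun b => lin_ext (g^~ b) u) v.
Proof.
rewrite /lin_ext; under eq_bigr do rewrite scaler_sumr.
rewrite exchange_big; apply: eq_bigr => b _; rewrite scaler_sumr.
by apply: eq_bigr => a _; rewrite !scalerA mulrC.
Qed.

Lemma eq_multilin_ext G1 G2 (s : seq B) :
  (forall us, G1 us = G2 us) -> multilin_ext G1 s = multilin_ext G2 s.
Proof.
elim: s G1 G2 => [|v s IH] G1 G2 eqG /=; first exact: eqG.
by apply: eq_lin_ext => u; apply: IH => us; apply: eqG.
Qed.

Lemma multilin_ext_sum I (r : seq I) (G : I -> seq W -> A) (s : seq B) :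
  multilin_ext (fun us => \sum_(i <- r) G i us) s =
  \sum_(i <- r) multilin_ext (G i) s.
Proof.
elim: s G => //= v s IH G; rewrite -lin_ext_sum.
by apply: eq_lin_ext => u; rewrite IH.
Qed.

Lemma multilin_ext_cat G (s1 s2 : seq B) :
  multilin_ext G (s1 ++ s2) =
  multilin_ext (fun a => multilin_ext (fun b => G (a ++ b)) s2) s1.
Proof.
by elim: s1 G => //= v s1 IH G; apply: eq_lin_ext => u; rewrite IH.
Qed.

Lemma multilin_ext_lin (G : W -> seq W -> A) (v : B) (s : seq B) :
  multilin_ext (fun us => lin_ext (G^~ us) v) s =
  lin_ext (fun u => multilin_ext (G u) s) v.
Proof.
elim: s G => //= u s IH G; rewrite [RHS]lin_ext_exchange.
by apply: eq_lin_ext => a; rewrite (IH (fun b us => G b (a :: us))).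
Qed.

Lemma multilin_ext_exchange (G : seq W -> seq W -> A) (s1 s2 : seq B) :
  multilin_ext (fun a => multilin_ext (G a) s2) s1 =
  multilin_ext (fun b => multilin_ext (G^~ b) s1) s2.
Proof.
elim: s1 G => //= v s1 IH G; rewrite multilin_ext_lin.
by apply: eq_lin_ext => u; rewrite IH.
Qed.

Lemma lin_extD (g1 g2 : W -> A) (v : B) :
  lin_ext (fun u => g1 u + g2 u) v = lin_ext g1 v + lin_ext g2 v.
Proof.
by rewrite /lin_ext -big_split; apply: eq_bigr => u _; rewrite scalerDr.
Qed.

Lemma multilin_extD (G1 G2 : seq W -> A) (s : seq B) :
  multilin_ext (fun us => G1 us + G2 us) s =
  multilin_ext G1 s + multilin_ext G2 s.
Proof.
elim: s G1 G2 => //= v s IH G1 G2; rewrite -lin_extD.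
by apply: eq_lin_ext => u; rewrite IH.
Qed.

Lemma multilin_ext_cuts (G : seq W -> seq W -> A) (s : seq B) :
  multilin_ext (fun a => \sum_(p <- cuts a) G p.1 p.2) s =
  \sum_(P <- cuts s) multilin_ext (fun a => multilin_ext (G a) P.2) P.1.
Proof.
elim: s G => [|v s IH] G; first by rewrite /= !big_seq1.
rewrite sum_cuts_cons /= -lin_ext_sum -lin_extD; apply: eq_lin_ext => u.
rewrite -(IH (fun a => G (u :: a))) -multilin_extD.
by apply: eq_multilin_ext => us; rewrite sum_cuts_cons.
Qed.

Lemma multilin_ext_linear (G : seq W -> A) (s1 s2 : seq B) :
  linear (fun v => multilin_ext G (s1 ++ v :: s2)).
Proof.
elim: s1 G => [|u s1 IH] G a x y /=; first exact: lin_ext_linear.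
rewrite /lin_ext scaler_sumr -big_split; apply: eq_bigr => w _ /=.
by rewrite (IH (fun us => G (w :: us))) scalerDr !scalerA mulrC.
Qed.

End Codomain.

Section LinearImage.
Variables A A' : lmodType F.

Lemma linear_lin_ext (f : A -> A') (g : W -> A) (v : B) :
  linear f -> f (lin_ext g v) = lin_ext (fun u => f (g u)) v.
Proof.
move=> lin_f.
pose fM := GRing.isLinear.Build _ _ _ _ f lin_f.
pose fL : {linear A -> A'} := HB.pack f fM.
rewrite -[LHS]/(fL _) raddf_sum; apply: eq_bigr => u _.
exact: (linearZ_LR fL).
Qed.

Lemma linear_multilin_ext (f : A -> A') (G : seq W -> A) (s : seq B) :
  linear f -> f (multilin_ext G s) = multilin_ext (fun us => f (G us)) s.
Proof.
move=> lin_f; elim: s G => //= v s IH G; rewrite (linear_lin_ext _ _ lin_f).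
by apply: eq_lin_ext => u; rewrite IH.
Qed.

End LinearImage.

Lemma lin_ext_id (v : B) : lin_ext (@word F M) v = v.
Proof.
rewrite [RHS]monalgE; apply: eq_bigr => u _.
by apply/malgP => w; rewrite mcoeffZ !mcoeffU mulrnAr mulr1.
Qed.

Lemma Br_brace_nil (v : B) : Br_brace [::] v = v.
Proof.
rewrite -[RHS]lin_ext_id; apply: eq_lin_ext => u.
suff -> : bword_brace [::] u = [:: u] by rewrite big_seq1.
elim/bword_eq_ind: u => x us IH /=; rewrite -[RHS]/(map (BWord x) [:: us]).
congr map; elim: us IH => //= u us IHus IH.
rewrite IH ?mem_head // IHus // => v0 us_v0.
by apply: IH; rewrite inE us_v0 orbT.
Qed.

Lemma Br_brace_linearr (s : seq B) : linear (Br_brace s).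
Proof.
move=> a x y; rewrite /Br_brace.
have lin_a : linear (fun z : B => a *: z).
  by move=> b u v; rewrite scalerDr !scalerA mulrC.
have scaleE (G : seq W -> B) : a *: multilin_ext G s = multilin_ext (fun us => a *: G us) s.
  exact: (linear_multilin_ext G s lin_a).
by rewrite scaleE -multilin_extD; apply: eq_multilin_ext => us; apply: lin_ext_linear.
Qed.

Lemma lin_ext_Br_brace (A : lmodType F) (g : W -> A) (s : seq B) (v : B) :
  lin_ext g (Br_brace s v) =
  multilin_ext (fun us => lin_ext (fun u =>
    \sum_(t <- bword_brace us u) g t) v) s.
Proof.
rewrite /Br_brace linear_multilin_ext; last exact: lin_ext_linear.
apply: eq_multilin_ext => us; rewrite linear_lin_ext; last exact: lin_ext_linear.
apply: eq_lin_ext => u.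
have lin_g := lin_ext_linear g.
pose gM := GRing.isLinear.Build _ _ _ _ _ lin_g.
pose gL : {linear B -> A} := HB.pack (@lin_ext F M A g) gM.
rewrite -[LHS]/(gL _) raddf_sum; by apply: eq_bigr => t _; apply: lin_ext_word.
Qed.

Lemma multilin_ext_insertions (A : lmodType F) (G : seq W -> A)
    (s r : seq B) :
  multilin_ext (fun a => multilin_ext (fun b =>
    \sum_(t <- insertions (@bword_brace M) b a) G t) r) s =
  \sum_(t <- insertions (fun v u => [:: Br_brace v u]) r s) multilin_ext G t.
Proof.
elim: r s G => [|v r IH] s G.
  by rewrite /= big_seq1; apply: eq_multilin_ext => us; rewrite big_seq1.
rewrite sum_insertions_cons.
pose L a1 q1 q2 := lin_ext (fun u => multilin_ext (fun us =>
  \sum_(t <- bword_brace q1 u)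
  \sum_(x <- insertions (@bword_brace M) us q2) G (a1 ++ t :: x)) r) v.
transitivity (\sum_(p <- cuts s) \sum_(q <- cuts p.2)
  multilin_ext (fun a1 => multilin_ext (fun q1 => multilin_ext (L a1 q1) q.2) q.1)
    p.1).
  transitivity (multilin_ext (fun a => \sum_(p <- cuts a)
      \sum_(q <- cuts p.2) L p.1 q.1 q.2) s).
    apply: eq_multilin_ext => a /=; rewrite /L.
    under eq_bigr do rewrite -lin_ext_sum; rewrite -lin_ext_sum.
    apply: eq_lin_ext => u.
    under eq_bigr do rewrite -multilin_ext_sum; rewrite -multilin_ext_sum.
    by apply: eq_multilin_ext => us; rewrite sum_insertions_cons.
  rewrite (multilin_ext_cuts (fun a b => \sum_(q <- cuts b) L a q.1 q.2)).
  apply: eq_bigr => p _; rewrite -multilin_ext_sum.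
  by apply: eq_multilin_ext => a; rewrite multilin_ext_cuts.
apply: eq_bigr => p _; apply: eq_bigr => q _; rewrite big_seq1.
under [RHS]eq_bigr do rewrite multilin_ext_cat /=.
rewrite -multilin_ext_sum; apply: eq_multilin_ext => a.
rewrite -lin_ext_sum lin_ext_Br_brace; apply: eq_multilin_ext => q1.
rewrite multilin_ext_lin; apply: eq_lin_ext => u.
under [RHS]eq_bigr do rewrite -IH.
rewrite -multilin_ext_sum; apply: eq_multilin_ext => b.
by rewrite -multilin_ext_sum.
Qed.

Lemma Br_brace_brace (s r : seq B) (v : B) :
  Br_brace s (Br_brace r v) =
  \sum_(t <- insertions (fun v u => [:: Br_brace v u]) r s) Br_brace t v.
Proof.
rewrite -multilin_ext_insertions; apply: eq_multilin_ext => a.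
rewrite lin_ext_Br_brace; apply: eq_multilin_ext => b.
rewrite -lin_ext_sum; apply: eq_lin_ext => u.
exact: sum_bword_brace_brace.
Qed.

HB.instance Definition _ := Lmodule_isBraceAlgebra.Build F (Br F M)
  Br_brace_nil
  (fun s1 s2 a => multilin_ext_linear _ s1 s2)
  Br_brace_linearr Br_brace_brace.

End ExtensionTheory.

Section Freeness.
Variables (F : fieldType) (M : nat) (A : braceAlgType F) (f : 'I_M -> A).

Fixpoint bword_eval (w : bword M) : A :=
  let: BWord x us := w in brace (map bword_eval us) (f x).

Lemma brace_lin_ext (vs : seq (Br F M)) (a : A) :
  brace (map (lin_ext bword_eval) vs) a =
  multilin_ext (fun us => brace (map bword_eval us) a) vs.
Proof.
rewrite -[map _ vs]cat0s.
transitivity (multilin_ext (fun us => brace ([::] ++ map bword_eval us) a) vs);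
  last by [].
elim: vs [::] => //= v vs IH s.
rewrite (linear_lin_ext _ _ (brace_linearl s _ a)).
apply: eq_lin_ext => u; rewrite -cat_rcons IH.
by apply: eq_multilin_ext => us; rewrite cat_rcons.
Qed.

Lemma sum_cuts_map (T1 T2 : Type) (Z : zmodType) (h : T1 -> T2) (s : seq T1)
    (g : seq T2 -> seq T2 -> Z) :
  \sum_(p <- cuts (map h s)) g p.1 p.2 =
  \sum_(p <- cuts s) g (map h p.1) (map h p.2).
Proof.
elim: s g => [|x s IH] g; first by rewrite !big_seq1.
by rewrite !sum_cuts_cons (IH (fun a => g (h x :: a))).
Qed.

Lemma bword_eval_brace (V : seq (bword M)) (w : bword M) :
  \sum_(t <- bword_brace V w) bword_eval t =
  brace (map bword_eval V) (bword_eval w).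
Proof.
elim/bword_eq_ind: w V => x us IH V; rewrite big_map /= brace_brace.
suff forestP (s : seq A) :
    \sum_(t <- insertions (@bword_brace M) us V)
      brace (s ++ map bword_eval t) (f x) =
    \sum_(t <- insertions (fun v u => [:: brace v u]) (map bword_eval us)
                 (map bword_eval V)) brace (s ++ t) (f x).
  exact: (forestP [::]).
elim: us IH V s => [|u us IHus] IH V s; first by rewrite !big_seq1.
rewrite !sum_insertions_cons.
rewrite (sum_cuts_map _ _ (fun a b => \sum_(q <- cuts b)
  \sum_(t <- [:: brace q.1 (bword_eval u)])
  \sum_(r <- insertions (fun v u => [:: brace v u]) (map bword_eval us) q.2)
    brace (s ++ a ++ t :: r) (f x))).
apply: eq_bigr => p _.
rewrite (sum_cuts_map _ _ (fun b c => \sum_(t <- [:: brace b (bword_eval u)])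
  \sum_(r <- insertions (fun v u => [:: brace v u]) (map bword_eval us) c)
    brace (s ++ map bword_eval p.1 ++ t :: r) (f x))).
apply: eq_bigr => q _; rewrite big_seq1 -IH ?mem_head //.
have {}IHus := IHus (fun v us_v => IH v (mem_behead (s := u :: us) us_v)).
transitivity (\sum_(t <- bword_brace q.1 u)
  \sum_(r <- insertions (fun v u => [:: brace v u]) (map bword_eval us)
               (map bword_eval q.2))
    brace (s ++ map bword_eval p.1 ++ bword_eval t :: r) (f x)).
  apply: eq_bigr => t _.
  under [RHS]eq_bigr do rewrite catA -cat_rcons.
  by rewrite -IHus; apply: eq_bigr => r _; rewrite cat_rcons map_cat /= catA.
rewrite exchange_big; apply: eq_bigr => r _; rewrite catA.
pose h y := brace ((s ++ map bword_eval p.1) ++ y :: r) (f x).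
have lin_h : linear h by apply: brace_linearl.
pose hM := GRing.isLinear.Build _ _ _ _ h lin_h.
pose hL : {linear A -> A} := HB.pack h hM.
rewrite -[RHS]/(hL _) raddf_sum; apply: eq_bigr => t _.
by rewrite catA.
Qed.

Theorem Br_free :
  exists2 phi : Br F M -> A,
    brace_morphism phi /\ (forall i, phi (gen F i) = f i) &
    forall psi : Br F M -> A, brace_morphism psi ->
      (forall i, psi (gen F i) = f i) -> psi =1 phi.
Proof.
exists (lin_ext bword_eval).
  split=> [|i]; last by rewrite lin_ext_word /= brace_nil.
  split=> [|s a]; first exact: lin_ext_linear.
  rewrite lin_ext_Br_brace brace_lin_ext; apply: eq_multilin_ext => us.
  rewrite (linear_lin_ext _ _ (brace_linearr _)); apply: eq_lin_ext => u.
  exact: bword_eval_brace.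
move=> psi [lin_psi psiM] psi_gen v.
rewrite -[v in LHS]lin_ext_id (linear_lin_ext _ _ lin_psi).
apply: eq_lin_ext; elim/bword_eq_ind => x us IH.
have -> : word F (BWord x us) = brace (map (@word F M) us) (gen F x).
  rewrite /brace /= /Br_brace /gen.
  have -> G : multilin_ext G (map (@word F M) us) = G us :> Br F M.
    by elim: us {IH} G => //= u us IH G; rewrite lin_ext_word IH.
  by rewrite lin_ext_word /= big_seq1.
rewrite psiM psi_gen /= -map_comp; congr (brace _ _).
by apply/eq_in_map => u /IH.
Qed.

End Freeness.

Section Tame.
Variables (F : fieldType) (M : nat).
Implicit Type phi : Br F M -> Br F M.

(* Br(x_1, ..., x_(i-1), x_(i+1), ..., x_M) inside Br(x_1, ..., x_M): the span
   of the normal brace words without the letter x_i. *)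
Definition free_of (i : 'I_M) (f : Br F M) : Prop :=
  forall w, w \in msupp f -> i \notin letters w.

Definition elementary phi : Prop :=
  brace_automorphism phi /\
  exists i : 'I_M,
    (forall j, j != i -> phi (gen F j) = gen F j) /\
    (exists (alpha : F) (f : Br F M),
       [/\ alpha != 0, free_of i f & phi (gen F i) = alpha *: gen F i + f]).

Definition tame phi : Prop :=
  exists (n : nat) (psi : 'I_n -> Br F M -> Br F M),
    (forall k, elementary (psi k)) /\
    phi =1 \big[(fun g h => g \o h)/id]_(k < n) psi k.

End Tame.

(* Main.v *)
Require Import Defs.
From HB Require Import structures.
From mathcomp Require Import all_boot all_order all_algebra finmap.
From mathcomp Require Import monalg.
From mathcomp Require Import zify.

Set Implicit Arguments.
Unset Strict Implicit.
Unset Printing Implicit Defensive.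

Import GRing.Theory.
Local Open Scope ring_scope.

(** As in the theorems of Jung, van der Kulk, Czerniakiewicz and
    Makar-Limanov, tameness follows from a Euclidean reduction: if [phi] is an
    automorphism of [B = Br F 2] and [phi x_1], [phi x_2] are not both linear,
    then the leading part of one of them is a brace polynomial in the leading
    part of the other, and subtracting that polynomial, which is composing
    [phi] with an elementary automorphism, lowers the sum of the two degrees
    ([degree_reduction], [tame_of_degree]). When both images are linear, row
    reduction finishes ([linear_tame]).

    The leading parts satisfy a nonzero relation because the generators are
    polynomials in [phi x_1] and [phi x_2] ([lead_relation]). The heart of the
    matter is thus that of two homogeneous elements [f], [g] satisfying a
    relation, the one of larger degree, say [g], is a polynomial in the other
    ([dependent_pair]).

    To see this, let [U] be the space of finite sequences of brace words, that
    is the tensor algebra of [B], with the product [a * b] given by the sum of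
    all insertions of [a] into [b]. The brace identity says that [U] acts on
    [B], and [B] is the free [U]-module on the letters. A relation between [f]
    and [g] becomes [p f + q g = 0] with [p], [q] in the tensor algebra [T(C)]
    on the subalgebra [C] generated by [f] and [g], and [p], [q] are not both
    zero if the relation is minimal ([reduced_relation]).

    First, [U] behaves like a free associative algebra: extracting the head of
    the words with a fixed tail gives enough left [U]-linear coordinates of
    lower degree ([chead_umul], [coordinate]) for cancellation ([umul_eq0]) and
    for a two-term weak algorithm ([weak_algorithm]). It provides [c] in [U], of
    degree [deg g - deg f], such that [p = - q * c] and hence [g = c f].

    Secondly, [c] lies in [T(C)], because [q] and [q * c] do ([tmap_descent]).
    Up to shorter sequences, the product of [U] is the shuffle product
    ([mpart_umul]), which has no zero divisors in characteristic zero
    ([ushuf_neq0]) and for which contraction of the first letter against a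
    functional is a derivation ([contract_ushuf]); functionals vanishing on [C]
    then detect a leading part of [c] outside of [T(C)].

    As the degree of [c] is less than that of [g], the entries of [c] are in
    fact polynomials in [f] alone, and so is [g = c f]. *)

(** * Linear maps out of free modules *)

Section LinearMaps.
Variables (F : fieldType) (A B : lmodType F) (f : A -> B).
Hypothesis lin_f : linear f.

Let fL : {linear A -> B} := HB.pack f (GRing.isLinear.Build _ _ _ _ f lin_f).

Lemma lin0 : f 0 = 0. Proof. exact: (raddf0 fL). Qed.
Lemma linD x y : f (x + y) = f x + f y. Proof. exact: (raddfD fL). Qed.
Lemma linN x : f (- x) = - f x. Proof. exact: (raddfN fL). Qed.
Lemma linB x y : f (x - y) = f x - f y. Proof. exact: (raddfB fL). Qed.
Lemma linZ a x : f (a *: x) = a *: f x. Proof. exact: (linearZ_LR fL). Qed.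
Lemma lin_sum I r (P : pred I) (g : I -> A) :
  f (\sum_(i <- r | P i) g i) = \sum_(i <- r | P i) f (g i).
Proof. exact: (raddf_sum fL). Qed.

End LinearMaps.

Lemma linear_comp (F : fieldType) (A B C : lmodType F) (f : B -> C) (g : A -> B) :
  linear f -> linear g -> linear (fun x => f (g x)).
Proof. by move=> lf lg a x y; rewrite lg lf. Qed.

Lemma linear_sub (F : fieldType) (A B : lmodType F) (f g : A -> B) :
  linear f -> linear g -> linear (fun x => f x - g x).
Proof. by move=> lf lg a x y; rewrite lf lg scalerBr opprD addrACA. Qed.

Lemma linear_add (F : fieldType) (A B : lmodType F) (f g : A -> B) :
  linear f -> linear g -> linear (fun x => f x + g x).
Proof. by move=> lf lg a x y; rewrite lf lg scalerDr addrACA. Qed.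

Lemma linear_scale (F : fieldType) (A B : lmodType F) (c : F) (f : A -> B) :
  linear f -> linear (fun x => c *: f x).
Proof. by move=> lf a x y; rewrite lf scalerDr !scalerA mulrC. Qed.

Lemma linear_id (F : fieldType) (A : lmodType F) : linear (fun x : A => x).
Proof. by []. Qed.

HB.lock Definition mlin (F : fieldType) (K : choiceType) (A : lmodType F)
    (g : K -> A) (v : {malg F[K]}) : A :=
  \sum_(k <- msupp v) v@_k *: g k.

Section FreeModules.
Variables (F : fieldType) (K : choiceType).
Implicit Types (v : {malg F[K]}).

Lemma mlinE (A : lmodType F) (g : K -> A) v :
  mlin g v = \sum_(k <- msupp v) v@_k *: g k.
Proof. by rewrite unlock. Qed.

Lemma mlin_fset (A : lmodType F) (d : {fset K}) (g : K -> A) v :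
  (msupp v `<=` d)%fset -> mlin g v = \sum_(k <- d) v@_k *: g k.
Proof.
move=> le_d; rewrite mlinE (big_fset_incl _ le_d) // => u _ ?.
by rewrite mcoeff_outdom // scale0r.
Qed.

Lemma mlin_linear (A : lmodType F) (g : K -> A) : linear (mlin g).
Proof.
move=> a u v; pose d := (msupp u `|` msupp v)%fset.
rewrite (@mlin_fset _ d _ (a *: u + v)); last first.
  apply: fsubset_trans (msuppD_le _ _) _.
  by apply: fsetUSS => //; apply: msuppZ_le.
rewrite (@mlin_fset _ d _ u) ?fsubsetUl // (@mlin_fset _ d _ v) ?fsubsetUr //.
rewrite scaler_sumr -big_split; apply: eq_bigr => w _ /=.
by rewrite mcoeffD mcoeffZ scalerDl scalerA.
Qed.

Lemma mlinU (A : lmodType F) (g : K -> A) k : mlin g << k >> = g k.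
Proof. by rewrite mlinE msuppU oner_eq0 big_seq_fset1 mcoeffUU scale1r. Qed.

Lemma eq_mlin (A : lmodType F) (g1 g2 : K -> A) v :
  {in msupp v, g1 =1 g2} -> mlin g1 v = mlin g2 v.
Proof. by move=> eq_g; rewrite !mlinE; apply: eq_big_seq => k /eq_g ->. Qed.

Lemma mlin_id v : mlin (fun k => << k >>) v = v.
Proof.
rewrite mlinE [RHS]monalgE; apply: eq_bigr => u _.
by apply/malgP => w; rewrite mcoeffZ !mcoeffU mulrnAr mulr1.
Qed.

Lemma lin_mlin (A B : lmodType F) (f : A -> B) (g : K -> A) v :
  linear f -> f (mlin g v) = mlin (fun k => f (g k)) v.
Proof.
by move=> lf; rewrite !mlinE (lin_sum lf); apply: eq_bigr => k _; rewrite (linZ lf).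
Qed.

Lemma eq_linear (A : lmodType F) (f1 f2 : {malg F[K]} -> A) v :
  linear f1 -> linear f2 -> {in msupp v, forall k, f1 << k >> = f2 << k >>} ->
  f1 v = f2 v.
Proof.
move=> l1 l2 eq12; rewrite -[v]mlin_id (lin_mlin _ _ l1) (lin_mlin _ _ l2).
exact: eq_mlin.
Qed.

Lemma mlin_linearr (A B : lmodType F) (g : K -> A -> B) v :
  (forall k, linear (g k)) -> linear (fun x => mlin (fun k => g k x) v).
Proof.
move=> lg a x y; rewrite !mlinE scaler_sumr -big_split; apply: eq_bigr => k _ /=.
by rewrite lg scalerDr !scalerA mulrC.
Qed.

Lemma mlin0 v : mlin (fun _ => 0 : {malg F[K]}) v = 0.
Proof. by rewrite mlinE big1 // => k _; rewrite scaler0. Qed.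

Lemma linear_mcoeff k : linear (fun v => v@_k : F^o).
Proof. by move=> a u v; rewrite mcoeffD mcoeffZ. Qed.

Lemma mcoeff_neq0P v : v != 0 -> exists k, v@_k != 0.
Proof.
case: (fset_0Vmem (msupp v)) => [v0|[k kv] _]; last first.
  by exists k; rewrite mcoeff_neq0.
case/eqP; apply/malgP => k.
by rewrite mcoeff0 mcoeff_outdom // v0 in_fset0.
Qed.

Definition mpart (P : pred K) v : {malg F[K]} :=
  mlin (fun k => if P k then << k >> else 0) v.

Lemma mpart_linear P : linear (mpart P).
Proof. exact: mlin_linear. Qed.

Lemma mpartU (P : pred K) k : mpart P << k >> = if P k then << k >> else 0.
Proof. exact: mlinU. Qed.

Lemma mcoeff_mpart P v k : (mpart P v)@_k = if P k then v@_k else 0.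
Proof.
apply: (@eq_linear F^o (fun v => (mpart P v)@_k)
                      (fun v => if P k then v@_k else 0)).
- exact: (linear_comp (linear_mcoeff k) (mpart_linear P)).
- case: (P k) => a x y; last by rewrite scaler0 addr0.
  exact: linear_mcoeff.
move=> j _ /=; rewrite /mpart mlinU.
have [->|neq_jk] := eqVneq j k; first by case: (P k); rewrite ?mcoeff0.
by case: (P j); case: (P k); rewrite ?mcoeff0 // mcoeffU (negbTE neq_jk).
Qed.

Lemma mem_mpart P v k : (k \in msupp (mpart P v)) = P k && (k \in msupp v).
Proof.
by rewrite -!mcoeff_neq0 mcoeff_mpart; case: (P k); rewrite //= eqxx.
Qed.

Lemma mpart_id (P : pred K) v : {in msupp v, forall k, P k} -> mpart P v = v.
Proof.
move=> Pv; apply/malgP => k; rewrite mcoeff_mpart; case: ifP => // nPk.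
by rewrite mcoeff_outdom //; apply/negP => /Pv; rewrite nPk.
Qed.

Lemma mpart_eq0 (P : pred K) v : {in msupp v, forall k, ~~ P k} -> mpart P v = 0.
Proof.
move=> Pv; apply/malgP => k; rewrite mcoeff_mpart mcoeff0; case: ifP => // Pk.
by rewrite mcoeff_outdom //; apply/negP => /Pv; rewrite Pk.
Qed.

Section Supports.
Implicit Type u : {malg F[K]}.

Lemma mem_msuppD u v k :
  k \in msupp (u + v) -> (k \in msupp u) || (k \in msupp v).
Proof.
by move=> kuv; have := fsubsetP (msuppD_le u v) k kuv; rewrite in_fsetE.
Qed.

Lemma mem_msuppB u v k :
  k \in msupp (u - v) -> (k \in msupp u) || (k \in msupp v).
Proof. by move=> /mem_msuppD; rewrite msuppN. Qed.

Lemma mem_msuppZ a v k : k \in msupp (a *: v) -> k \in msupp v.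
Proof. exact: (fsubsetP (msuppZ_le a v)). Qed.

Lemma mem_msuppU k j : (k \in msupp (<< j >> : {malg F[K]})) = (k == j).
Proof. by rewrite msuppU oner_eq0 in_fset1. Qed.

Lemma mem_msupp0 k : k \in msupp (0 : {malg F[K]}) = false.
Proof. by rewrite msupp0. Qed.

Lemma mem_msupp_sum (I : eqType) (r : seq I) (f : I -> {malg F[K]}) k :
  k \in msupp (\sum_(i <- r) f i) -> exists2 i, i \in r & k \in msupp (f i).
Proof.
elim: r => [|i r IH]; first by rewrite big_nil msupp0.
rewrite big_cons => /mem_msuppD /orP[ki|/IH [j jr kj]].
  by exists i; rewrite ?mem_head.
by exists j; rewrite // inE jr orbT.
Qed.

End Supports.

End FreeModules.

Lemma mem_msupp_mlin (F : fieldType) (K J : choiceType) (g : K -> {malg F[J]})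
    (v : {malg F[K]}) j :
  j \in msupp (mlin g v) -> exists2 k, k \in msupp v & j \in msupp (g k).
Proof.
by rewrite mlinE => /mem_msupp_sum [k kv] /mem_msuppZ jk; exists k.
Qed.

(** * Weights of brace words *)

Section Cuts.
Variable T : eqType.

Lemma mem_cuts (V : seq T) (p : seq T * seq T) : p \in cuts V -> V = p.1 ++ p.2.
Proof.
elim: V p => [|x V IH] p /=; first by rewrite inE => /eqP ->.
by rewrite inE => /orP[/eqP -> //|/mapP [q /IH -> ->]].
Qed.

Variables (br : seq T -> T -> seq T).

Lemma mem_insertions_cons u us V (r : seq T) :
  r \in insertions br (u :: us) V ->
  exists (p q : seq T * seq T) t (r' : seq T),
  [/\ p \in cuts V, q \in cuts p.2, t \in br q.1 u,
      r' \in insertions br us q.2 & r = p.1 ++ t :: r'].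
Proof.
move=> /= /flattenP [s1 /mapP [p Vp ->]] /flattenP [s2 /mapP [q pq ->]].
by case/allpairsP => -[t r'] /= [tq rq ->]; exists p, q, t, r'.
Qed.

Lemma size_insertions us V (r : seq T) :
  r \in insertions br us V -> (size us <= size r <= size us + size V)%N.
Proof.
elim: us V r => [|u us IH] V r; first by rewrite inE => /eqP ->; rewrite leqnn.
case/mem_insertions_cons => p [q [t [r' [/mem_cuts -> /mem_cuts -> _ /IH]]]] H ->.
rewrite !size_cat /=; move: H; lia.
Qed.

Lemma sum_insertions (mu : T -> nat) us V (r : seq T) :
  {in us, forall u V t, t \in br V u -> mu t = \sum_(v <- V) mu v + mu u}%N ->
  r \in insertions br us V ->
  (\sum_(x <- r) mu x = \sum_(x <- V) mu x + \sum_(x <- us) mu x)%N.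
Proof.
elim: us V r => [|u us IH] V r mu_br.
  by rewrite inE big_nil addn0 => /eqP ->.
case/mem_insertions_cons => p [q [t [r' [/mem_cuts -> /mem_cuts -> tq]]]].
move=> r'q ->; rewrite !big_cat /= !big_cons.
rewrite (IH _ _ _ r'q) => [|v v_us]; last by apply: mu_br; rewrite inE v_us orbT.
rewrite (mu_br _ (mem_head _ _) _ _ tq).
lia.
Qed.

End Cuts.

Section Weights.
Variables (M : nat) (om : 'I_M -> nat).

Definition wt (w : bword M) : nat := \sum_(x <- letters w) om x.
Definition wts (s : seq (bword M)) : nat := \sum_(w <- s) wt w.

Lemma wt_BWord x us : wt (BWord x us) = (om x + wts us)%N.
Proof.
rewrite /wt /= big_cons; congr addn; rewrite big_flatten big_map.
by rewrite /wts.
Qed.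

Lemma wts_cons w s : wts (w :: s) = (wt w + wts s)%N.
Proof. by rewrite /wts big_cons. Qed.

Lemma wts_cat s1 s2 : wts (s1 ++ s2) = (wts s1 + wts s2)%N.
Proof. by rewrite /wts big_cat. Qed.

Lemma wt_bword_brace V w t : t \in bword_brace V w -> wt t = (wts V + wt w)%N.
Proof.
elim/bword_eq_ind: w V t => x us IH V t /= /mapP [r rV ->].
by rewrite !wt_BWord {1}/wts (sum_insertions IH rV) -!/(wts _); lia.
Qed.

Lemma wts_insertions us V r :
  r \in insertions (@bword_brace M) us V -> wts r = (wts V + wts us)%N.
Proof. by apply: sum_insertions => u _ V' t; apply: wt_bword_brace. Qed.

End Weights.

Lemma bword_brace_nil M (w : bword M) : bword_brace [::] w = [:: w].
Proof.
elim/bword_eq_ind: w => x us IH /=; rewrite -[RHS]/(map (BWord x) [:: us]).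
congr map; elim: us IH => //= u us IHus IH.
rewrite IH ?mem_head //= IHus // => v us_v.
by apply: IH; rewrite inE us_v orbT.
Qed.

Lemma insertions_nil M (us : seq (bword M)) :
  insertions (@bword_brace M) us [::] = [:: us].
Proof. by elim: us => //= u us IH; rewrite bword_brace_nil /= IH. Qed.

Definition homog F M (om : 'I_M -> nat) d (v : Br F M) :=
  {in msupp v, forall w, wt om w = d}.

Definition deg M : bword M -> nat := wt (fun=> 1%N).
Definition degs M : seq (bword M) -> nat := wts (fun=> 1%N).

Lemma deg_gt0 M (w : bword M) : (0 < deg w)%N.
Proof. by case: w => x us; rewrite /deg wt_BWord. Qed.

Lemma degs_eq0 M (s : seq (bword M)) : (degs s == 0%N) = (s == [::]).
Proof.
case: s => [|w s]; first by rewrite /degs /wts big_nil.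
rewrite /degs wts_cons; have := deg_gt0 w; rewrite /deg; case: (wt _ w) => //.
Qed.

Lemma wt_letter_eq0 M (i : 'I_M) w :
  (wt (fun k => (k == i) : nat) w == 0%N) = (i \notin letters w).
Proof.
rewrite /wt; elim: (letters w) => [|x s IH]; first by rewrite big_nil.
by rewrite big_cons addn_eq0 IH inE negb_or eqb0 eq_sym.
Qed.

Lemma free_ofP F M i (v : Br F M) :
  free_of i v <-> homog (fun k => (k == i) : nat) 0 v.
Proof.
by split=> H w /H; [rewrite -wt_letter_eq0 => /eqP | rewrite -wt_letter_eq0 => ->].
Qed.

(** * The enveloping algebra of the free brace algebra *)

Section Envelope.
Variables (F : fieldType) (M : nat).
Local Notation W := (bword M).
Local Notation B := (Br F M).
Local Notation U := {malg F[seq W]}.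
Local Notation wd := (@word F M).

Lemma lin_extE (A : lmodType F) (g : W -> A) (v : B) : lin_ext g v = mlin g v.
Proof. by rewrite mlinE. Qed.

Lemma multilin_ext_word (A : lmodType F) (G : seq W -> A) (s : seq W) :
  multilin_ext G (map wd s) = G s.
Proof. by elim: s G => //= w s IH G; rewrite lin_ext_word IH. Qed.

Lemma brace_words (s : seq W) (v : B) :
  brace (map wd s) v = mlin (fun w => \sum_(t <- bword_brace s w) wd t) v.
Proof. by rewrite /brace /= /Br_brace multilin_ext_word lin_extE. Qed.

Lemma mem_multilin_ext (J : choiceType) (G : seq W -> {malg F[J]}) (vs : seq B) t :
  t \in msupp (multilin_ext G vs) ->
  exists2 us, all2 (fun u (v : B) => u \in msupp v) us vs & t \in msupp (G us).
Proof.
elim: vs G t => [|v vs IH] G t /=; first by exists [::].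
rewrite lin_extE => /mem_msupp_mlin [u uv] /IH [us us_vs tG].
by exists (u :: us) => //=; rewrite uv.
Qed.

(** The pure tensor of the entries of [vs], expanded in words. *)
Definition tens (vs : seq B) : U := multilin_ext (fun s => << s >> : U) vs.

Lemma mlin_tens (A : lmodType F) (g : seq W -> A) vs :
  mlin g (tens vs) = multilin_ext g vs.
Proof.
rewrite /tens (linear_multilin_ext _ _ (mlin_linear g)).
by apply: eq_multilin_ext => s; rewrite mlinU.
Qed.

Lemma tens_words s : tens (map wd s) = << s >>.
Proof. exact: multilin_ext_word. Qed.

Lemma mem_tens t vs :
  t \in msupp (tens vs) -> all2 (fun u (v : B) => u \in msupp v) t vs.
Proof. by case/mem_multilin_ext => us; rewrite mem_msuppU => ? /eqP ->. Qed.

Lemma tens_cons v vs :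
  tens (v :: vs) = mlin (fun u => mlin (fun us => << u :: us >>) (tens vs)) v.
Proof.
by rewrite /= -lin_extE; apply: eq_lin_ext => u; rewrite mlin_tens.
Qed.

Lemma tens_linear s1 s2 : linear (fun v => tens (s1 ++ v :: s2)).
Proof. exact: multilin_ext_linear. Qed.

(** The action of a sequence of words by the corresponding brace operation, and
    the product that turns it into a module structure. *)
Definition uact (p : U) (v : B) : B := mlin (fun s => brace (map wd s) v) p.

Definition umul (p a : U) : U :=
  mlin (fun s => mlin (fun t => \sum_(r <- insertions (@bword_brace M) t s) << r >>)
                      a) p.

Lemma uact_linearl v : linear (uact^~ v).
Proof. exact: mlin_linear. Qed.

Lemma uact_linearr p : linear (uact p).
Proof. by apply: mlin_linearr => s; apply: brace_linearr. Qed.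

Lemma umul_linearl a : linear (umul^~ a).
Proof. exact: mlin_linear. Qed.

Lemma umul_linearr p : linear (umul p).
Proof. by apply: mlin_linearr => s; apply: mlin_linear. Qed.

Lemma uactU s w : uact << s >> (wd w) = \sum_(t <- bword_brace s w) wd t.
Proof. by rewrite /uact mlinU brace_words mlinU. Qed.

Lemma uactUl s v : uact << s >> v = brace (map wd s) v.
Proof. by rewrite /uact mlinU. Qed.

Lemma umulU s t :
  umul << s >> << t >> = \sum_(r <- insertions (@bword_brace M) t s) << r >>.
Proof. by rewrite /umul !mlinU. Qed.

Lemma uact_tens vs v : uact (tens vs) v = brace vs v.
Proof.
rewrite /uact mlin_tens /brace /= {2}/Br_brace.
by apply: eq_multilin_ext => s; rewrite -[LHS]/(brace _ _) brace_words lin_extE.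
Qed.

Lemma umul_tens (s r : seq B) :
  umul (tens s) (tens r) =
  \sum_(t <- insertions (fun v u => [:: brace v u]) r s) tens t.
Proof.
rewrite /umul mlin_tens -[RHS]multilin_ext_insertions.
by apply: eq_multilin_ext => a; rewrite mlin_tens.
Qed.

(** The brace identity. *)
Lemma uact_umul p q v : uact p (uact q v) = uact (umul p q) v.
Proof.
apply: (@eq_linear _ _ _ (fun p => uact p (uact q v)) (fun p => uact (umul p q) v)).
- exact: uact_linearl.
- exact: linear_comp (uact_linearl v) (umul_linearl q).
move=> s _ /=.
apply: (@eq_linear _ _ _ (fun q => uact << s >> (uact q v))
                         (fun q => uact (umul << s >> q) v)).
- exact: linear_comp (uact_linearr _) (uact_linearl v).
- exact: linear_comp (uact_linearl v) (umul_linearr _).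
move=> t _ /=; rewrite umulU.
apply: (@eq_linear _ _ _ (fun v => uact << s >> (uact << t >> v))
  (fun v => uact (\sum_(r <- insertions (@bword_brace M) t s) << r >>) v)).
- exact: linear_comp (uact_linearr _) (uact_linearr _).
- exact: uact_linearr.
move=> w _; rewrite -/(word F w) uactU (lin_sum (uact_linearr _)).
rewrite (lin_sum (uact_linearl _)).
under eq_bigr do rewrite uactU.
by rewrite sum_bword_brace_brace; apply: eq_bigr => r _; rewrite uactU.
Qed.

(** The coordinates of [B] as a free [U]-module on the letters. *)
Definition croot (x : 'I_M) : B -> U :=
  mlin (fun w => let: BWord y us := w in if y == x then << us >> else 0).

Lemma croot_linear x : linear (croot x).
Proof. exact: mlin_linear. Qed.

Lemma crootU x y us :
  croot x (wd (BWord y us)) = if y == x then << us >> else 0.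
Proof. by rewrite /croot mlinU. Qed.

Lemma mcoeff_croot x (v : B) us : (croot x v)@_us = v@_(BWord x us).
Proof.
apply: (@eq_linear _ _ F^o (fun v => (croot x v)@_us) (fun v => v@_(BWord x us))).
- exact: linear_comp (linear_mcoeff _) (croot_linear x).
- exact: linear_mcoeff.
case=> y vs _; rewrite -/(word F _) crootU /word.
case: eqP => [->|neq_yx].
  rewrite !mcoeffU; congr (_ *+ nat_of_bool _).
  by apply/eqP/eqP => [->|[]].
rewrite mcoeff0 mcoeffU; case: eqP => // -[eq_yx]; by case: neq_yx.
Qed.

Lemma croot_uact x p v : croot x (uact p v) = umul p (croot x v).
Proof.
apply: (@eq_linear _ _ _ (fun p => croot x (uact p v)) (fun p => umul p (croot x v))).
- exact: linear_comp (croot_linear x) (uact_linearl v).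
- exact: umul_linearl.
move=> s _ /=.
apply: (@eq_linear _ _ _ (fun v => croot x (uact << s >> v))
                         (fun v => umul << s >> (croot x v))).
- exact: linear_comp (croot_linear x) (uact_linearr _).
- exact: linear_comp (umul_linearr _) (croot_linear x).
case=> y us _; rewrite -/(word F _) uactU crootU (lin_sum (croot_linear x)) big_map.
under eq_bigr do rewrite crootU.
case: (y == x); first by rewrite umulU.
by rewrite big1 // (lin0 (umul_linearr _)).
Qed.

Lemma brace_gen us x : brace (map wd us) (gen F x) = wd (BWord x us).
Proof. by rewrite brace_words /gen mlinU /= big_seq1. Qed.

Lemma sum_croot v : v = \sum_x uact (croot x v) (gen F x).
Proof.
apply: (@eq_linear _ _ _ (fun v => v)
           (fun v => \sum_x uact (croot x v) (gen F x))) => //.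
  move=> a u w; rewrite scaler_sumr -big_split; apply: eq_bigr => x _ /=.
  by rewrite croot_linear uact_linearl.
case=> y us _; rewrite -/(word F _) (bigD1 y) //= crootU eqxx.
rewrite uactUl brace_gen big1 ?addr0 // => x neq_xy.
by rewrite crootU eq_sym (negbTE neq_xy) (lin0 (uact_linearl _)).
Qed.

(** This map from [U] to [B] is [U]-linear up to words whose tails have a larger
    degree than [m]; see [chead_umul]. *)
Definition chead (m : seq W) : U -> B :=
  mlin (fun s => if s is t :: m' then if m' == m then wd t else 0 else 0).

Lemma chead_linear m : linear (chead m).
Proof. exact: mlin_linear. Qed.

Lemma cheadU m t m' : chead m << t :: m' >> = if m' == m then wd t else 0.
Proof. by rewrite /chead mlinU. Qed.

Lemma mcoeff_chead m (a : U) t : (chead m a)@_t = a@_(t :: m).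
Proof.
apply: (@eq_linear _ _ F^o (fun a => (chead m a)@_t) (fun a => a@_(t :: m))).
- exact: linear_comp (linear_mcoeff _) (chead_linear m).
- exact: linear_mcoeff.
case=> [|y vs] _; first by rewrite /chead mlinU mcoeff0 mcoeffU.
rewrite cheadU /word mcoeffU eqseq_cons.
have [_|_] := eqVneq vs m; first by rewrite mcoeffU andbT.
by rewrite andbF mcoeff0.
Qed.

Lemma sum_cuts_nil_l (T : Type) (Z : zmodType) (V : seq T) (g : seq T * seq T -> Z) :
  (forall x V1 V2, V = x :: V1 ++ V2 -> g (x :: V1, V2) = 0) ->
  \sum_(p <- cuts V) g p = g ([::], V).
Proof.
elim: V g => [|x V IH] g g0; first by rewrite big_seq1.
rewrite sum_cuts_cons (IH (fun p => g (x :: p.1, p.2))) => [|y V1 V2 eV].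
  by rewrite (g0 x [::] V) ?addr0.
by rewrite (g0 x (y :: V1) V2) // eV.
Qed.

Lemma sum_cuts_nil_r (T : Type) (Z : zmodType) (V : seq T) (g : seq T * seq T -> Z) :
  (forall V1 x V2, V = V1 ++ x :: V2 -> g (V1, x :: V2) = 0) ->
  \sum_(p <- cuts V) g p = g (V, [::]).
Proof.
elim: V g => [|x V IH] g g0; first by rewrite big_seq1.
rewrite sum_cuts_cons (g0 [::]) // add0r.
rewrite (IH (fun p => g (x :: p.1, p.2))) => [//|V1 y V2 eV].
by rewrite (g0 (x :: V1)) // eV.
Qed.

(** A word of [s * (b :: t)] whose tail has at most the degree of [t] arises
    only by inserting all of [s] into [b]: anything in front of [b], behind it,
    or inside the words of [t], adds to the degree of the tail. *)
Lemma chead_umul m p a :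
  {in msupp a, forall s, s != [::] /\ (degs m <= degs (behead s))%N} ->
  chead m (umul p a) = uact p (chead m a).
Proof.
move=> tail_a.
apply: (@eq_linear _ _ _ (fun p => chead m (umul p a)) (fun p => uact p (chead m a))).
- exact: linear_comp (chead_linear m) (umul_linearl a).
- exact: uact_linearl.
move=> s _ /=.
apply: (@eq_linear _ _ _ (fun a => chead m (umul << s >> a))
                         (fun a => uact << s >> (chead m a))).
- exact: linear_comp (chead_linear m) (umul_linearr _).
- exact: linear_comp (uact_linearr _) (chead_linear m).
case=> [|b t] in_a; have [ne le_mt] := tail_a _ in_a; first by case/eqP: ne.
rewrite umulU cheadU (lin_sum (chead_linear m)) sum_insertions_cons.
rewrite sum_cuts_nil_l => [|x V1 V2 _ /=]; last first.
  rewrite big1 // => q _; rewrite big1 // => y _; rewrite big1_seq // => r /andP[_ rt].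
  rewrite cheadU; case: eqP => // em; exfalso.
  have := wts_insertions (fun=> 1%N) rt; have := deg_gt0 y.
  by move: le_mt; rewrite -em /degs /deg /= wts_cat wts_cons; lia.
rewrite sum_cuts_nil_r => [|V1 x V2 _ /=]; last first.
  rewrite big1 // => y _; rewrite big1_seq // => r /andP[_ rt].
  rewrite cheadU; case: eqP => // em; exfalso.
  have := wts_insertions (fun=> 1%N) rt; have := deg_gt0 x.
  by rewrite wts_cons; move: le_mt; rewrite -em /degs /deg /=; lia.
rewrite insertions_nil /=; under eq_bigr do rewrite big_seq1 cheadU.
case: (t == m); first by rewrite uactU.
by rewrite big1 // (lin0 (uact_linearr _)).
Qed.

End Envelope.

(** * Cancellation and the weak algorithm *)

Definition homogU F M d (a : {malg F[seq (bword M)]}) :=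
  {in msupp a, forall s, degs s = d}.

Section WeakAlgorithm.
Variables (F : fieldType) (M : nat).
Local Notation W := (bword M).
Local Notation B := (Br F M).
Local Notation U := {malg F[seq W]}.
Local Notation wd := (@word F M).
Local Notation one := (<< [::] >> : U).
Local Notation ud := (fun=> 1%N : nat).

Lemma umulr1 p : umul p one = p.
Proof.
apply: (@eq_linear _ _ _ (fun p => umul p one) (fun p => p)) => //.
  exact: umul_linearl.
by move=> s _; rewrite umulU big_seq1.
Qed.

Lemma homogU0_scalar (a : U) : homogU 0 a -> a = a@_[::] *: one.
Proof.
move=> a0; apply/malgP => s; rewrite mcoeffZ mcoeffU.
case: eqVneq => [<-|ns]; first by rewrite mulr1.
rewrite mulr0 mcoeff_outdom //; apply/negP => /a0 /eqP.
by rewrite degs_eq0 eq_sym (negbTE ns).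
Qed.

Lemma homog_croot d x (v : B) : homog ud d v -> homogU d.-1 (croot x v).
Proof.
move=> vd us; rewrite -mcoeff_neq0 mcoeff_croot mcoeff_neq0 => /vd.
by rewrite wt_BWord => <-.
Qed.

Lemma homogU_coordinate d m x (a : U) :
  homogU d a -> homogU (d - (degs m).+1) (croot x (chead m a)).
Proof.
move=> ad us; rewrite -mcoeff_neq0 mcoeff_croot mcoeff_chead mcoeff_neq0 => /ad.
by rewrite /degs wts_cons wt_BWord; lia.
Qed.

(** Among the tails of the words in [a] and [b], one of least degree: extracting
    it commutes with left multiplication, lowers the degree, and cannot kill both
    elements. *)
Lemma coordinate d e (a b : U) :
  homogU d a -> homogU e b -> (0 < d)%N -> (0 < e)%N -> (a != 0) || (b != 0) ->
  exists m x, let E := fun c => croot x (chead m c) in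
  [/\ forall p, E (umul p a) = umul p (E a),
      forall p, E (umul p b) = umul p (E b),
      (E a != 0) || (E b != 0) & 
      (E a != 0 -> (degs m < d)%N) /\ (E b != 0 -> (degs m < e)%N)].
Proof.
move=> ad be d_gt0 e_gt0 ab_neq0.
pose S : seq (seq W) := enum_fset (msupp a) ++ enum_fset (msupp b).
have memS s : s \in S = (s \in msupp a) || (s \in msupp b) by rewrite mem_cat.
have S_nil s : s \in S -> s != [::].
  rewrite memS -degs_eq0 -lt0n => /orP[/ad ->|/be ->] //.
(* Minimality over both supports makes [chead_umul] apply to both elements. *)
pose P n := has (fun s => degs (behead s) == n) S.
have exP : exists n, P n.
  have [s sS] : exists s, s \in S.
    by case/orP: ab_neq0 => /mcoeff_neq0P [s]; rewrite mcoeff_neq0 => sa;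
      exists s; rewrite memS sa ?orbT.
  by exists (degs (behead s)); apply/hasP; exists s.
case: (ex_minnP exP) => n /hasP [s sS /eqP s_n] min_n {exP}.
case: s sS s_n => [/S_nil //|t m] tmS /= m_n.
have min_m s : s \in S -> (degs m <= degs (behead s))%N.
  by move=> sS; rewrite m_n; apply: min_n; apply/hasP; exists s.
case: t tmS => x us tmS; exists m, x => /=; split.
- move=> p; rewrite chead_umul => [|s sa]; first exact: croot_uact.
  have sS: s \in S by rewrite memS sa.
  by split; [apply: S_nil | apply: min_m].
- move=> p; rewrite chead_umul => [|s sb]; first exact: croot_uact.
  have sS: s \in S by rewrite memS sb orbT.
  by split; [apply: S_nil | apply: min_m].
- have ne0 (c : U) : BWord x us :: m \in msupp c -> croot x (chead m c) != 0.
    move=> mc; apply/eqP => c0.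
    by move: mc; rewrite -mcoeff_neq0 -mcoeff_chead -mcoeff_croot c0 mcoeff0 eqxx.
  by move: tmS; rewrite memS => /orP[] /ne0 ne; apply/orP; [left | right].
- have lt_m n' (c : U) : homogU n' c -> croot x (chead m c) != 0 -> (degs m < n')%N.
    move=> cn /mcoeff_neq0P [vs].
    rewrite mcoeff_croot mcoeff_chead mcoeff_neq0 => /cn.
    by rewrite /degs wts_cons wt_BWord; lia.
  by split; apply: lt_m.
Qed.

(** Coordinates reduce this to a scalar [a]. *)
Lemma umul_eq0 d p (a : U) : homogU d a -> umul p a = 0 -> a != 0 -> p = 0.
Proof.
elim/ltn_ind: d a => d IH a ad pa0 a_neq0.
have [d0|d_gt0] := posnP d.
  move: ad pa0 a_neq0; rewrite d0 => /homogU0_scalar ->.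
  rewrite (linZ (umul_linearr p)) umulr1 => /eqP.
  rewrite !scaler_eq0 negb_or => pa0 /andP[a_neq0 _].
  by case/orP: pa0 => [a0|/eqP //]; rewrite a0 in a_neq0.
have := @coordinate d d a a ad ad d_gt0 d_gt0; rewrite a_neq0 => /(_ isT).
case=> m [x [Ea _]]; rewrite orbb => Ea0 [/(_ Ea0) lt_md _].
apply: (IH (d - (degs m).+1)%N _ (croot x (chead m a))) => //; first by lia.
  exact: homogU_coordinate.
by rewrite -Ea pa0 (lin0 (chead_linear m)) (lin0 (croot_linear x)).
Qed.

Lemma uact_eq0 d p (v : B) : homog ud d v -> uact p v = 0 -> v != 0 -> p = 0.
Proof.
move=> vd pv0 /mcoeff_neq0P [[x us]]; rewrite -mcoeff_croot => vx.
apply: (@umul_eq0 d.-1 p (croot x v)).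
- exact: homog_croot.
- by rewrite -croot_uact pv0 (lin0 (croot_linear x)).
by apply/eqP => v0; rewrite v0 mcoeff0 eqxx in vx.
Qed.

(** The graded form of Cohn's weak algorithm for two elements: a coordinate
    reduces the relation to one between elements of smaller degree, and the
    claim is immediate once [a] is a scalar. *)
Lemma weak_algorithm d e p q (a b : U) :
  homogU d a -> homogU e b -> (d <= e)%N -> a != 0 -> q != 0 ->
  umul p a + umul q b = 0 ->
  exists2 c, homogU (e - d) c & p + umul q c = 0.
Proof.
elim/ltn_ind: d e a b => d IH e a b ad be le_de a_neq0 q_neq0 rel.
have [d0|d_gt0] := posnP d.
  rewrite d0 in ad *; move: ad a_neq0 rel => /homogU0_scalar ->.
  rewrite scaler_eq0 negb_or => /andP[a_neq0 _].
  rewrite (linZ (umul_linearr p)) umulr1 => rel.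
  exists ((a@_[::])^-1 *: b).
    by move=> s /mem_msuppZ /be ->; rewrite subn0.
  rewrite (linZ (umul_linearr q)) -[p]scale1r -(mulVf a_neq0) -scalerA -scalerDr.
  by rewrite rel scaler0.
have e_gt0 : (0 < e)%N by apply: leq_trans le_de.
have := @coordinate d e a b ad be d_gt0 e_gt0; rewrite a_neq0 => /(_ isT).
case=> m [x [Ea Eb Eab_neq0 [lt_md lt_me]]].
pose E (c : U) := croot x (chead m c).
rewrite -!/(E _) in Ea Eb Eab_neq0 lt_md lt_me.
have lin_E : linear E by apply: linear_comp (croot_linear x) (chead_linear m).
have E_rel : umul p (E a) + umul q (E b) = 0.
  by rewrite -(Ea p) -(Eb q) -(linD lin_E) rel (lin0 lin_E).
have Ea_neq0 : E a != 0.
  apply/eqP => Ea0; move: Eab_neq0; rewrite Ea0 eqxx /= => Eb_neq0.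
  case/eqP: q_neq0; apply: (@umul_eq0 (e - (degs m).+1) q (E b)) => //.
    exact: homogU_coordinate.
  by move: E_rel; rewrite Ea0 (lin0 (umul_linearr p)) add0r.
have lt_d := lt_md Ea_neq0.
have lt_dd : (d - (degs m).+1 < d)%N by lia.
have le_de' : (d - (degs m).+1 <= e - (degs m).+1)%N by lia.
have [c cd pqc] := IH _ lt_dd (e - (degs m).+1)%N (E a) (E b)
  (homogU_coordinate (x := x) ad) (homogU_coordinate (x := x) be) le_de' Ea_neq0 q_neq0
  E_rel.
by exists c => // s /cd ->; lia.
Qed.

End WeakAlgorithm.

(** * Shuffles *)

Section Shuffle.
Variables (F : fieldType) (T : choiceType).
Local Notation U := {malg F[seq T]}.
Local Notation one := (<< [::] >> : U).

Fixpoint shuffles (s : seq T) : seq T -> seq (seq T) :=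
  if s is a :: s' then
    fix shuffles_s (t : seq T) : seq (seq T) :=
      if t is b :: t' then
        map (cons a) (shuffles s' t) ++ map (cons b) (shuffles_s t')
      else [:: s]
  else fun t => [:: t].

Definition ushuf (p q : U) : U :=
  mlin (fun s => mlin (fun t => \sum_(r <- shuffles s t) << r >>) q) p.

Lemma ushuf_linearl q : linear (ushuf^~ q).
Proof. exact: mlin_linear. Qed.

Lemma ushuf_linearr p : linear (ushuf p).
Proof. by apply: mlin_linearr => s; apply: mlin_linear. Qed.

Lemma ushufU s t : ushuf << s >> << t >> = \sum_(r <- shuffles s t) << r >>.
Proof. by rewrite /ushuf !mlinU. Qed.

Lemma shuffles_nil s : shuffles s [::] = [:: s].
Proof. by case: s. Qed.

Lemma sum_shuffles_cuts (Z : zmodType) (V : seq T) u us (g : seq T -> Z) :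
  \sum_(r <- shuffles V (u :: us)) g r =
  \sum_(p <- cuts V) \sum_(r <- shuffles p.2 us) g (p.1 ++ u :: r).
Proof.
elim: V g => [|v V IH] g; first by rewrite /= !big_seq1.
rewrite sum_cuts_cons /= big_cat !big_map addrC; congr (_ + _).
exact: (IH (fun r => g (v :: r))).
Qed.

(** Contractions play the role of partial derivatives for the shuffle product:
    unlike letter coefficients they can be taken along functionals adapted to a
    subspace of letters. *)
Definition contract (mu : T -> F) : U -> U :=
  mlin (fun s => if s is b :: s' then mu b *: << s' >> else 0).

Definition contracts (mus : seq (T -> F)) (u : U) : U :=
  foldl (fun u mu => contract mu u) u mus.

Lemma contract_linear mu : linear (contract mu).
Proof. exact: mlin_linear. Qed.

Lemma contractU mu b s : contract mu << b :: s >> = mu b *: << s >>.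
Proof. by rewrite /contract mlinU. Qed.

Lemma contract1 mu : contract mu one = 0.
Proof. by rewrite /contract mlinU. Qed.

Lemma contracts_linear mus : linear (contracts mus).
Proof.
elim: mus => //= mu mus IH; apply: (linear_comp IH); exact: contract_linear.
Qed.

(** The first letter of a shuffle comes from one of its two arguments. *)
Lemma contract_ushuf mu p q :
  contract mu (ushuf p q) = ushuf (contract mu p) q + ushuf p (contract mu q).
Proof.
have lin_c := contract_linear mu.
apply: (@eq_linear _ _ _ (fun p => contract mu (ushuf p q))
  (fun p => ushuf (contract mu p) q + ushuf p (contract mu q))).
- exact: linear_comp lin_c (ushuf_linearl q).
- apply: linear_add (ushuf_linearl _); exact: linear_comp (ushuf_linearl q) lin_c.
move=> s _ /=.
apply: (@eq_linear _ _ _ (fun q => contract mu (ushuf << s >> q))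
  (fun q => ushuf (contract mu << s >>) q + ushuf << s >> (contract mu q))).
- exact: linear_comp lin_c (ushuf_linearr _).
- apply: linear_add (ushuf_linearr _) _; exact: linear_comp (ushuf_linearr _) lin_c.
have shuf1 t : ushuf one << t >> = << t >> by rewrite ushufU big_seq1.
have shuf2 t : ushuf << t >> one = << t >> by rewrite ushufU shuffles_nil big_seq1.
move=> t _; case: s t => [|a s] [|b t].
- rewrite shuf1 !contract1 (lin0 (ushuf_linearl _)) (lin0 (ushuf_linearr _)).
  by rewrite addr0.
- rewrite shuf1 contract1 (lin0 (ushuf_linearl _)) add0r contractU.
  by rewrite (linZ (ushuf_linearr _)) shuf1.
- rewrite shuf2 contract1 (lin0 (ushuf_linearr _)) addr0 contractU.
  by rewrite (linZ (ushuf_linearl _)) shuf2.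
rewrite ushufU /= big_cat !big_map (linD lin_c) !(lin_sum lin_c) !contractU.
rewrite (linZ (ushuf_linearl _)) (linZ (ushuf_linearr _)) !ushufU !scaler_sumr.
by congr (_ + _); apply: eq_bigr => r _; rewrite contractU.
Qed.

Definition coord_at (a b : T) : F := (b == a)%:R.

Lemma mcoeff_contract a u s : (contract (coord_at a) u)@_s = u@_(a :: s).
Proof.
apply: (@eq_linear _ _ F^o (fun u => (contract (coord_at a) u)@_s)
                           (fun u => u@_(a :: s))).
- exact: linear_comp (linear_mcoeff _) (contract_linear _).
- exact: linear_mcoeff.
case=> [|b t] _; first by rewrite contract1 mcoeff0 mcoeffU.
rewrite contractU mcoeffZ !mcoeffU eqseq_cons /coord_at.
by case: (b == a); rewrite ?mul1r ?mul0r.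
Qed.

Lemma words_eq (u v : U) :
  u@_[::] = v@_[::] ->
  (forall a, contract (coord_at a) u = contract (coord_at a) v) -> u = v.
Proof.
move=> uv0 uvS; apply/malgP => -[//|a s].
by rewrite -!mcoeff_contract uvS.
Qed.

Definition shorter K (u : U) := {in msupp u, forall s, (size s < K)%N}.

Lemma shorter0 u : shorter 0 u -> u = 0.
Proof.
move=> u0; apply/malgP => s; rewrite mcoeff0 mcoeff_outdom //.
by apply/negP => /u0.
Qed.

Lemma shorter_contract K mu u : shorter K u -> shorter K.-1 (contract mu u).
Proof.
move=> uK s /mem_msupp_mlin [[|b t]]; first by rewrite mem_msupp0.
by move=> /uK; case: K {uK} => // K ltK /mem_msuppZ; rewrite mem_msuppU => /eqP ->.
Qed.

Lemma shorter_iter K mu i u :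
  shorter K u -> shorter (K - i) (iter i (contract mu) u).
Proof.
elim: i => [|i IH] uK; first by rewrite subn0.
by rewrite subnS; apply: shorter_contract; apply: IH.
Qed.

Lemma shorter_exists u : exists K, shorter K u.
Proof.
exists (\max_(s <- msupp u) size s).+1 => s su.
by rewrite ltnS; apply: (leq_bigmax_seq (F := size)).
Qed.

(** In the Leibniz formula for the power [i + j] of a derivation a single term
    survives. *)
Lemma iter_contract_ushuf mu i j p q :
  iter i.+1 (contract mu) p = 0 -> iter j.+1 (contract mu) q = 0 ->
  iter (i + j) (contract mu) (ushuf p q) =
  'C(i + j, i)%:R *: ushuf (iter i (contract mu) p) (iter j (contract mu) q).
Proof.
have linD_iter n : linear (iter n (contract mu)).
  elim: n => [|n IH] //; exact: linear_comp (contract_linear mu) IH.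
move En: (i + j)%N => n; elim: n i j En p q => [|n IH] i j En p q.
  case: i En => //; case: j => // _ _ _ /=; by rewrite bin0 scale1r.
move=> p0 q0; rewrite iterSr contract_ushuf (linD (linD_iter n)).
case: i En p0 => [|i] En p0.
  rewrite /= in p0; rewrite p0 (lin0 (ushuf_linearl _)) (lin0 (linD_iter n)) add0r.
  case: j En q0 => // j [En] q0; rewrite (IH 0%N j) //; last by rewrite -iterSr.
  by rewrite !bin0 -iterSr.
case: j En q0 => [|j] En q0.
  rewrite /= in q0; rewrite q0 (lin0 (ushuf_linearr _)) (lin0 (linD_iter n)) addr0.
  move: En; rewrite addn0 => -[En]; rewrite (IH i 0%N) ?addn0 //; last first.
    by rewrite -iterSr.
  by rewrite -En !binn -iterSr.
rewrite (IH i j.+1) -?iterSr //; last by move: En; lia.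
rewrite (IH i.+1 j) -?iterSr //; last by move: En; lia.
by rewrite -scalerDl -natrD addnC -binS.
Qed.

Lemma contract_height mu p : p != 0 ->
  exists2 i, iter i (contract mu) p != 0 & iter i.+1 (contract mu) p = 0.
Proof.
move=> p_neq0; have [K pK] := shorter_exists p.
have ex0 : exists i, iter i.+1 (contract mu) p == 0.
  exists K; apply/eqP/shorter0; have := shorter_iter (mu := mu) (i := K.+1) pK.
  by have -> : (K - K.+1 = 0)%N by lia.
case: (ex_minnP ex0) => i /eqP i0 min_i; exists i => //.
case: i min_i {i0} => // i min_i.
by apply/negP => /min_i; rewrite ltnn.
Qed.

Lemma letter_or_scalar p :
  (exists a, contract (coord_at a) p != 0) \/ p = p@_[::] *: one.
Proof.
have [->|] := eqVneq p (p@_[::] *: one); first by right; rewrite mcoeffZ mcoeffUU mulr1.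
rewrite -subr_eq0 => /mcoeff_neq0P [s]; rewrite mcoeffB mcoeffZ mcoeffU.
case: s => [|a s]; first by rewrite eqxx mulr1 subrr eqxx.
rewrite /= mulr0 subr0 => p_as; left; exists a; apply/eqP => p0.
by rewrite -mcoeff_contract p0 mcoeff0 eqxx in p_as.
Qed.

(** If [i] and [j] are the largest powers of a letter derivation that do not
    kill [p] and [q], its power [i + j] sends the product to a binomial multiple
    of a product of shorter elements; in characteristic zero this multiple is
    nonzero. *)
Lemma ushuf_neq0 p q : [pchar F] =i pred0 ->
  p != 0 -> q != 0 -> ushuf p q != 0.
Proof.
move=> charF0; have [K pK] := shorter_exists p; have [L qL] := shorter_exists q.
move En: (K + L)%N => n; move: En.
elim/ltn_ind: n K L p q pK qL => n IH K L p q pK qL En p_neq0 q_neq0.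
suff reduce a : contract (coord_at a) p != 0 \/ contract (coord_at a) q != 0 ->
    ushuf p q != 0.
  case: (letter_or_scalar p) => [[a pa]|ep]; first by apply: (reduce a); left.
  case: (letter_or_scalar q) => [[a qa]|eq]; first by apply: (reduce a); right.
  move: p_neq0 q_neq0; rewrite ep eq !scaler_eq0 !negb_or => /andP[p0 one0] /andP[q0 _].
  rewrite (linZ (ushuf_linearl _)) (linZ (ushuf_linearr _)) ushufU big_seq1.
  by rewrite !scaler_eq0 !negb_or p0 q0.
move=> pq_a; set D := contract (coord_at a) in pq_a.
have [i pi pi1] := contract_height (coord_at a) p_neq0.
have [j qj qj1] := contract_height (coord_at a) q_neq0.
have ij_gt0 : (0 < i + j)%N.
  rewrite lt0n addn_eq0; apply/negP => /andP[/eqP i0 /eqP j0].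
  by case: pq_a; [move: pi1; rewrite i0 | move: qj1; rewrite j0] => /= D0;
    rewrite /D D0 eqxx.
have gt0 N u : shorter N u -> u != 0 -> (0 < N)%N.
  by case: N => // /shorter0 ->; rewrite eqxx.
have K_gt0 := gt0 _ _ pK p_neq0; have L_gt0 := gt0 _ _ qL q_neq0.
have: ushuf (iter i D p) (iter j D q) != 0.
  have lt_n : (K - i + (L - j) < n)%N by lia.
  exact: (IH _ lt_n _ _ _ _ (shorter_iter pK) (shorter_iter qL)).
have := iter_contract_ushuf pi1 qj1; case: (ushuf p q =P 0) => // ->.
have -> : iter (i + j) (contract (coord_at a)) 0 = 0.
  by elim: (i + j)%N => //= m ->; rewrite (lin0 (contract_linear _)).
move/esym/eqP; rewrite scaler_eq0 => /orP[|/eqP -> //]; last by rewrite eqxx.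
move/pcharf0P: charF0 => -> /eqP C0.
by have := bin_gt0 (i + j) i; rewrite C0 leq_addr.
Qed.

(** If [lam] kills [q] at every position, contracting [ushuf q c] against [lam]
    at the first position where it does not kill [c] only sees [c]. *)
Lemma contracts_ushuf lam mus q c :
  (forall nus, contract lam (contracts nus q) = 0) ->
  (forall nus, (size nus < size mus)%N -> contract lam (contracts nus c) = 0) ->
  contract lam (contracts mus (ushuf q c)) =
  ushuf q (contract lam (contracts mus c)).
Proof.
elim: mus q c => [|mu mus IH] q c q0 c0.
  by rewrite /= contract_ushuf (q0 [::]) (lin0 (ushuf_linearl _)) add0r.
rewrite /= contract_ushuf (linD (contracts_linear _)) (linD (contract_linear _)).
rewrite IH; last 2 first.
- by move=> nus; apply: (q0 (mu :: nus)).
- by move=> nus lt_nus; apply: c0; rewrite /= ltnS ltnW.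
rewrite (c0 mus) ?ltnSn // (lin0 (ushuf_linearr _)) add0r IH //.
by move=> nus lt_nus; apply: (c0 (mu :: nus)).
Qed.

(** With no zero divisors, such a first position cannot exist. *)
Lemma contracts_ushuf_eq0 lam q c : [pchar F] =i pred0 -> q != 0 ->
  (forall nus, contract lam (contracts nus q) = 0) ->
  (forall nus, contract lam (contracts nus (ushuf q c)) = 0) ->
  forall nus, contract lam (contracts nus c) = 0.
Proof.
move=> charF0 q_neq0 q0 qc0 nus; move En: (size nus) => n.
elim/ltn_ind: n nus En => n IH nus En.
have := qc0 nus; rewrite contracts_ushuf // => [/eqP|mus lt_mus]; last first.
  by apply: (IH (size mus)) => //; rewrite -En.
by apply: contraTeq => /(ushuf_neq0 charF0 q_neq0).
Qed.

End Shuffle.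

(** * Tensor powers of linear maps *)

Section Multilinear.
Variables (F : fieldType) (M N : nat).

Lemma multilin_ext_comp (A : lmodType F) (G : seq (Br F N) -> A)
    (h : bword M -> Br F N) vs :
  (forall s1 s2, linear (fun v => G (s1 ++ v :: s2))) ->
  G (map (lin_ext h) vs) = multilin_ext (fun us => G (map h us)) vs.
Proof.
move=> lin_G; transitivity (multilin_ext (fun us => G ([::] ++ map h us)) vs);
  last by [].
rewrite -[map _ vs]cat0s; elim: vs [::] => //= v vs IH s.
rewrite (linear_lin_ext _ _ (lin_G s _)).
apply: eq_lin_ext => u; rewrite -cat_rcons IH.
by apply: eq_multilin_ext => us; rewrite cat_rcons.
Qed.

(** Evaluation commutes with insertion, tested against a multilinear [G]. *)
Lemma sum_insertions_eval (Z : lmodType F) (f : 'I_M -> Br F N) us V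
    (G : seq (Br F N) -> Z) :
  (forall s1 s2, linear (fun v => G (s1 ++ v :: s2))) ->
  \sum_(t <- insertions (@bword_brace M) us V) G (map (bword_eval f) t) =
  \sum_(t <- insertions (fun v u => [:: brace v u]) (map (bword_eval f) us)
               (map (bword_eval f) V)) G t.
Proof.
elim: us V G => [|u us IH] V G lin_G; first by rewrite !big_seq1.
rewrite map_cons !sum_insertions_cons.
rewrite (sum_cuts_map _ _ (fun a b => \sum_(q <- cuts b)
  \sum_(t <- [:: brace q.1 (bword_eval f u)])
  \sum_(r <- insertions (fun v u => [:: brace v u]) (map (bword_eval f) us) q.2)
    G (a ++ t :: r))).
apply: eq_bigr => p _.
rewrite (sum_cuts_map _ _ (fun b c => \sum_(t <- [:: brace b (bword_eval f u)])
  \sum_(r <- insertions (fun v u => [:: brace v u]) (map (bword_eval f) us) c)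
    G (map (bword_eval f) p.1 ++ t :: r))).
apply: eq_bigr => q _; rewrite big_seq1 -bword_eval_brace.
under [RHS]eq_bigr => r _ do rewrite (lin_sum (lin_G _ r)).
rewrite [RHS]exchange_big; apply: eq_bigr => t _ /=.
rewrite -(IH q.2 (fun r => G (map (bword_eval f) p.1 ++ bword_eval f t :: r))).
  by apply: eq_bigr => r _; rewrite map_cat.
move=> s1 s2 a x y; rewrite -!cat_cons !catA; exact: lin_G.
Qed.

End Multilinear.

Definition pairing (F : fieldType) (K : choiceType) (mu : K -> F)
    (v : {malg F[K]}) : F := mlin (mu : K -> F^o) v.

Section TensorMap.
Variables (F : fieldType) (M N : nat).
Local Notation U M := {malg F[seq (bword M)]}.
Implicit Types (h : bword M -> Br F N).

(** The linear map between tensor algebras induced by the linear extension of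
    [h] to letters. *)
Definition tmap h : U M -> U N := mlin (fun s => tens (map h s)).

Lemma tmap_linear h : linear (tmap h).
Proof. exact: mlin_linear. Qed.

Lemma tmapU h s : tmap h << s >> = tens (map h s).
Proof. by rewrite /tmap mlinU. Qed.

Lemma tmap_tens h vs : tmap h (tens vs) = tens (map (lin_ext h) vs).
Proof.
rewrite /tmap mlin_tens -(multilin_ext_comp _ vs) //; exact: tens_linear.
Qed.

Lemma eq_tmap h1 h2 (c : U M) :
  {in msupp c, forall s, {in s, h1 =1 h2}} -> tmap h1 c = tmap h2 c.
Proof. by move=> eq_h; apply: eq_mlin => s /eq_h/eq_in_map ->. Qed.

Lemma contract_tens (mu : bword N -> F) v vs :
  contract mu (tens (v :: vs)) = pairing mu v *: tens vs.
Proof.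
rewrite tens_cons (lin_mlin _ _ (contract_linear mu)).
transitivity (mlin (fun u => mu u *: tens vs) v).
  apply: eq_mlin => u _; rewrite (lin_mlin _ _ (contract_linear mu)).
  rewrite -[in RHS](mlin_id (tens vs)).
  rewrite (@lin_mlin _ _ _ _ (fun x => mu u *: x)); last first.
    exact: linear_scale (@linear_id _ _).
  by apply: eq_mlin => us _; rewrite contractU.
have lin_s : linear (fun a : F^o => a *: tens vs : U N).
  by move=> a x y; rewrite scalerDl scalerA.
exact: (esym (lin_mlin (mu : _ -> F^o) v lin_s)).
Qed.

Lemma tens_nil : tens [::] = << [::] >> :> U N.
Proof. exact: (tens_words F [::]). Qed.

Lemma contract_tmap mu h (c : U M) :
  contract mu (tmap h c) =
  tmap h (contract (fun w => pairing mu (h w)) c).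
Proof.
apply: (@eq_linear _ _ _ (fun c => contract mu (tmap h c))
  (fun c => tmap h (contract (fun w => pairing mu (h w)) c))).
- exact: linear_comp (contract_linear _) (tmap_linear h).
- apply: linear_comp (tmap_linear h) _; exact: contract_linear.
case=> [|w s] _; rewrite tmapU.
  by rewrite /= tens_nil !contract1 (lin0 (tmap_linear h)).
by rewrite map_cons contract_tens contractU (linZ (tmap_linear h)) tmapU.
Qed.

Lemma size_tens (vs : seq (Br F N)) t : t \in msupp (tens vs) -> size t = size vs.
Proof. by move/mem_tens; rewrite all2E => /andP[/eqP]. Qed.

Lemma mpart_tmap h k (c : U M) :
  mpart (fun s => size s == k) (tmap h c) = tmap h (mpart (fun s => size s == k) c).
Proof.
apply: (@eq_linear _ _ _ (fun c => mpart (fun s => size s == k) (tmap h c))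
  (fun c => tmap h (mpart (fun s => size s == k) c))).
- exact: linear_comp (mpart_linear _) (tmap_linear h).
- exact: linear_comp (tmap_linear h) (mpart_linear _).
move=> s _; rewrite tmapU mpartU.
case: eqP => [sk|/eqP sk].
  by rewrite mpart_id ?tmapU // => t /size_tens ->; rewrite size_map sk.
rewrite (lin0 (tmap_linear h)) mpart_eq0 // => t /size_tens ->.
by rewrite size_map.
Qed.

Lemma mcoeff_tmap_nil h (c : U M) : (tmap h c)@_[::] = c@_[::].
Proof.
apply: (@eq_linear _ _ F^o (fun c => (tmap h c)@_[::]) (fun c => c@_[::])).
- exact: linear_comp (linear_mcoeff _) (tmap_linear h).
- exact: linear_mcoeff.
case=> [|w s] _; rewrite tmapU; first by rewrite /= tens_nil !mcoeffU.
rewrite mcoeffU mcoeff_outdom //.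
by apply/negP => /size_tens.
Qed.

Lemma contracts_tmap h nus (c : U M) :
  exists nus', contracts nus (tmap h c) = tmap h (contracts nus' c).
Proof.
elim: nus c => [|nu nus IH] c; first by exists [::].
rewrite /= contract_tmap.
have [nus' ->] := IH (contract (fun w => pairing nu (h w)) c).
by exists ((fun w => pairing nu (h w)) :: nus').
Qed.

End TensorMap.

Lemma tmap_comp F M N P (g : bword N -> Br F P) (h : bword M -> Br F N) c :
  tmap g (tmap h c) = tmap (fun w => lin_ext g (h w)) c.
Proof.
apply: (@eq_linear _ _ _ (fun c => tmap g (tmap h c))
                         (fun c => tmap (fun w => lin_ext g (h w)) c)).
- exact: linear_comp (tmap_linear g) (tmap_linear h).
- exact: tmap_linear.
by move=> s _; rewrite !tmapU tmap_tens -map_comp.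
Qed.

(** By induction on the length: contracting the first position of [tmap h c]
    against a coordinate functional differs from contracting that of [c] by a
    contraction of the error [w - h w]. *)
Lemma tmap_fixed F M (h : bword M -> Br F M) (c : {malg F[seq (bword M)]}) :
  (forall t nus, contract (fun w => (word F w - h w)@_t) (contracts nus c) = 0) ->
  tmap h c = c.
Proof.
have [K cK] := shorter_exists c; elim: K c cK => [|K IH] c cK err0.
  by rewrite (shorter0 cK) (lin0 (tmap_linear h)).
apply: words_eq => [|a]; first exact: mcoeff_tmap_nil.
rewrite contract_tmap.
have -> : contract (fun w => pairing (coord_at F a) (h w)) c =
    contract (coord_at F a) c.
  rewrite -[RHS]subr0 -(err0 a [::]).
  apply: (@eq_linear _ _ _ (contract (fun w => pairing (coord_at F a) (h w)))
    (fun c => contract (coord_at F a) c - contract (fun w => (word F w - h w)@_a) c)).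
  - exact: contract_linear.
  - apply: linear_sub; exact: contract_linear.
  case=> [|w s] _; first by rewrite !contract1 subr0.
  rewrite !contractU -scalerBl mcoeffB; congr (_ *: _).
  rewrite /word mcoeffU /coord_at opprB addrCA subrr addr0.
  rewrite /pairing -[in RHS](mlin_id (h w)) (lin_mlin _ _ (linear_mcoeff a)).
  by apply: (@eq_mlin F _ F^o) => b _; rewrite mcoeffU.
apply: IH => [|t nus]; first exact: shorter_contract cK.
exact: (err0 t (coord_at F a :: nus)).
Qed.

(** * Evaluation of brace polynomials *)

HB.lock Definition beval (F : fieldType) M N (f : 'I_M -> Br F N) :
    Br F M -> Br F N := lin_ext (bword_eval f).

Section Evaluation.
Variables (F : fieldType) (M N : nat) (f : 'I_M -> Br F N).
Local Notation ev := (bword_eval f).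
Local Notation E := (beval f).

Lemma bevalE v : E v = lin_ext ev v.
Proof. by rewrite unlock. Qed.

Lemma eval_linear : linear E.
Proof. by rewrite unlock; apply: lin_ext_linear. Qed.

Lemma eval_word w : E << w >> = ev w.
Proof. by rewrite unlock; apply: lin_ext_word. Qed.

Lemma eval_gen i : E (gen F i) = f i.
Proof. by rewrite /gen /word eval_word /= brace_nil. Qed.

Lemma eval_brace s a : E (brace s a) = brace (map E s) (E a).
Proof.
rewrite unlock /brace /= lin_ext_Br_brace -[RHS]/(brace _ _) brace_lin_ext.
apply: eq_multilin_ext => us.
rewrite (linear_lin_ext _ _ (brace_linearr _)); apply: eq_lin_ext => u.
exact: bword_eval_brace.
Qed.

Lemma eval_uact p v : E (uact p v) = uact (tmap ev p) (E v).
Proof.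
apply: (@eq_linear _ _ _ (fun p => E (uact p v)) (fun p => uact (tmap ev p) (E v))).
- exact: linear_comp eval_linear (uact_linearl v).
- exact: linear_comp (uact_linearl _) (tmap_linear _).
move=> s _ /=; rewrite tmapU uact_tens uactUl eval_brace -map_comp.
by congr (brace _ _); apply: eq_map => w; rewrite /= /word eval_word.
Qed.

(** A brace morphism induces a morphism between the enveloping algebras. *)
Lemma tmap_umul p q : tmap ev (umul p q) = umul (tmap ev p) (tmap ev q).
Proof.
apply: (@eq_linear _ _ _ (fun p => tmap ev (umul p q))
                         (fun p => umul (tmap ev p) (tmap ev q))).
- exact: linear_comp (tmap_linear _) (umul_linearl q).
- exact: linear_comp (umul_linearl _) (tmap_linear _).
move=> s _ /=.
apply: (@eq_linear _ _ _ (fun q => tmap ev (umul << s >> q))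
                         (fun q => umul (tmap ev << s >>) (tmap ev q))).
- exact: linear_comp (tmap_linear _) (umul_linearr _).
- exact: linear_comp (umul_linearr _) (tmap_linear _).
move=> t _ /=; rewrite umulU (lin_sum (tmap_linear _)) !tmapU.
under eq_bigr do rewrite tmapU.
rewrite sum_insertions_eval; last exact: tens_linear.
by rewrite umul_tens.
Qed.

End Evaluation.

(** * Descent of divisibility to a subalgebra *)

(** Gaussian elimination: [E] has a linear quasi-inverse on the span of
    finitely many basis elements. *)
Lemma quasi_inverse (F : fieldType) (K J : choiceType)
    (E : {malg F[K]} -> {malg F[J]}) (ws : seq K) : linear E ->
  exists sg : {malg F[J]} -> {malg F[K]},
  [/\ linear sg, forall b, {subset msupp (sg b) <= ws} &
      {in ws, forall w, E (sg (E << w >>)) = E << w >>}].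
Proof.
move=> lin_E; elim: ws => [|w ws [sg [lin_sg sg_ws sgK]]].
  exists (fun _ => 0); split=> // [a x y|b k]; first by rewrite scaler0 addr0.
  by rewrite mem_msupp0.
pose w' := << w >> - sg (E << w >>).
have ws' b k : k \in msupp (sg b) -> k \in w :: ws.
  by move/sg_ws; rewrite inE => ->; rewrite orbT.
have Ew' : E w' = E << w >> - E (sg (E << w >>)) by rewrite (linB lin_E).
have [w'0|/mcoeff_neq0P [j w'j]] := eqVneq (E w') 0.
  exists sg; split=> // u; rewrite inE => /orP[/eqP ->|/sgK //].
  by apply/esym/eqP; rewrite -subr_eq0 -Ew' w'0.
(* The correction is a functional that vanishes on the old span and is 1 on [w']. *)
pose kappa (b : {malg F[J]}) : F^o := (b - E (sg b))@_j / (E w')@_j.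
have lin_kappa : linear kappa.
  move=> a x y; rewrite /kappa.
  have -> : a *: x + y - E (sg (a *: x + y)) = a *: (x - E (sg x)) + (y - E (sg y)).
    by rewrite lin_sg lin_E scalerBr opprD addrACA.
  by rewrite [(a *: _ + _)@__]mcoeffD [(a *: _)@__]mcoeffZ mulrDl -mulrA.
exists (fun b => sg b + kappa b *: w'); split.
- move=> a x y; rewrite lin_sg lin_kappa scalerDl -[(a *: kappa x) *: w']scalerA.
  by rewrite addrACA -scalerDr.
- move=> b k /mem_msuppD /orP[/ws' //|/mem_msuppZ /mem_msuppB /orP[]].
    by rewrite mem_msuppU => /eqP ->; rewrite mem_head.
  exact: ws'.
move=> u; rewrite inE => /orP[/eqP ->|u_ws]; rewrite (linD lin_E) (linZ lin_E).
  by rewrite /kappa -Ew' divff // scale1r Ew' addrC subrK.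
by rewrite /kappa (sgK _ u_ws) subrr mcoeff0 mul0r scale0r addr0.
Qed.

Section TopLength.
Variables (F : fieldType) (M : nat).
Local Notation W := (bword M).
Local Notation U := {malg F[seq W]}.

Lemma size_shuffles (T : choiceType) (s t r : seq T) :
  r \in shuffles s t -> size r = (size s + size t)%N.
Proof.
elim: s t r => [|a s IHs] t r; first by rewrite inE => /eqP ->.
elim: t r => [|b t IHt] r; first by rewrite inE => /eqP -> /=; rewrite addn0.
rewrite [shuffles _ _]/= mem_cat => /orP[] /mapP [r' r'P ->] /=.
  by rewrite (IHs _ _ r'P).
by rewrite (IHt _ r'P) /= !addnS.
Qed.

Lemma size_insertions_le (t s r : seq W) :
  r \in insertions (@bword_brace M) t s -> (size r <= size t + size s)%N.
Proof. by case/size_insertions/andP. Qed.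

(** An interval inserted into an entry of [t] disappears from the sequence, so
    in the longest insertions all entries of [t] receive the empty interval. *)
Lemma insertions_shuffles (Z : zmodType) s t (G : seq W -> Z) :
  (forall r, (size r < size s + size t)%N -> G r = 0) ->
  \sum_(r <- insertions (@bword_brace M) t s) G r = \sum_(r <- shuffles s t) G r.
Proof.
elim: t s G => [|u t IH] s G G0; first by rewrite shuffles_nil !big_seq1.
rewrite sum_insertions_cons sum_shuffles_cuts big_seq [RHS]big_seq.
apply: eq_bigr => p /mem_cuts es.
rewrite sum_cuts_nil_l => [|x V1 V2 ep /=]; last first.
  rewrite big1 // => y _; rewrite big1_seq // => r /andP[_ /size_insertions_le r_le].
  apply: G0; rewrite es ep !size_cat /= size_cat; lia.
rewrite bword_brace_nil big_seq1 -IH // => r r_lt.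
by apply: G0; rewrite es !size_cat /= -addnA ltn_add2l addnS ltnS; apply: r_lt.
Qed.

(** The associated graded of the filtration by length is the shuffle algebra. *)
Lemma mpart_umul k l (q c : U) :
  shorter k.+1 q -> shorter l.+1 c ->
  mpart (fun s => size s == (k + l)%N) (umul q c) =
  ushuf (mpart (fun s => size s == k) q) (mpart (fun s => size s == l) c).
Proof.
move=> qk cl.
have lin_m n : linear (mpart (fun s : seq W => size s == n) : U -> U).
  exact: mpart_linear.
apply: (@eq_linear _ _ _ (fun q => mpart (fun s => size s == (k + l)%N) (umul q c))
  (fun q => ushuf (mpart (fun s => size s == k) q) (mpart (fun s => size s == l) c))).
- exact: linear_comp (lin_m _) (umul_linearl c).
- exact: linear_comp (ushuf_linearl _) (lin_m _).
move=> s /qk sk.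
apply: (@eq_linear _ _ _
  (fun c => mpart (fun s => size s == (k + l)%N) (umul << s >> c))
  (fun c => ushuf (mpart (fun s => size s == k) << s >>)
                  (mpart (fun s => size s == l) c))).
- exact: linear_comp (lin_m _) (umul_linearr _).
- exact: linear_comp (ushuf_linearr _) (lin_m _).
move=> t /cl tl; rewrite umulU (lin_sum (lin_m _)).
under eq_bigr do rewrite mpartU.
rewrite !mpartU.
have [/andP[/eqP es /eqP et]|st] := boolP ((size s == k) && (size t == l)).
  rewrite es et !eqxx ushufU insertions_shuffles => [|r]; last first.
    by rewrite es et; case: eqP => // ->; rewrite ltnn.
  rewrite big_seq [RHS]big_seq; apply: eq_bigr => r /size_shuffles ->.
  by rewrite es et eqxx.
rewrite [RHS](_ : _ = 0); last first.
  move: st; case: eqP => _; case: eqP => _ //= _.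
  - exact: (lin0 (ushuf_linearr _)).
  - exact: (lin0 (ushuf_linearl _)).
  - exact: (lin0 (ushuf_linearl _)).
rewrite big1_seq // => r /andP[_ /size_insertions_le r_le]; case: eqP => // er.
have [sk' tl'] : (@size W s <= k)%N /\ (@size W t <= l)%N.
  by split; [apply: sk | apply: tl].
have le_kl : (k + l <= @size W t + @size W s)%N by rewrite -er; apply: r_le.
case/negP: st; apply/andP; split; apply/eqP.
  by change (@size W s = k); lia.
by change (@size W t = l); lia.
Qed.

Lemma top_length (q : U) : q != 0 ->
  exists2 k, shorter k.+1 q & mpart (fun s => size s == k) q != 0.
Proof.
move=> q_neq0; have [K] := shorter_exists q; elim: K => [|K IH] qK.
  by rewrite (shorter0 qK) eqxx in q_neq0.
have [q0|qK0] := eqVneq (mpart (fun s => size s == K) q) 0; last by exists K.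
apply: IH => s sq; have := qK s sq; rewrite ltnS leq_eqVlt => /orP[/eqP sK|//].
have : s \in msupp (mpart (fun s => size s == K) q) by rewrite mem_mpart sK eqxx.
by rewrite q0 mem_msupp0.
Qed.

End TopLength.

(** The image of [tmap ev] is the tensor algebra on the subalgebra generated by
    the [f i]. To divide by [q] within it, compare parts of greatest length,
    where the product is the shuffle product, contract against the coefficients
    of [rho], which kill the subalgebra, and proceed with [c] minus its longest
    part. The quotient is explicit because, up to degree [d], [rho] is
    complementary to evaluation after [sg]: a tensor killed by [rho] at every
    position does not change when [sg] and the evaluation are applied to its
    entries. *)
Lemma tmap_descent (F : fieldType) (M N d : nat) (f : 'I_M -> Br F N)
    (sg : bword N -> Br F M) (rho : bword N -> Br F N)
    (q r : {malg F[seq (bword M)]}) (c : {malg F[seq (bword N)]}) :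
  [pchar F] =i pred0 ->
  (forall w, lin_ext rho (bword_eval f w) = 0) ->
  (forall t, (deg t <= d)%N -> word F t - rho t = beval f (sg t)) ->
  (forall s t, s \in msupp c -> t \in s -> (deg t <= d)%N) ->
  tmap (bword_eval f) q != 0 ->
  umul (tmap (bword_eval f) q) c = tmap (bword_eval f) r ->
  c = tmap (bword_eval f) (tmap sg c).
Proof.
move=> charF0 rho0 rho_sg cd q_neq0.
set ev := bword_eval f in rho0 rho_sg q_neq0 *; set q0 := tmap ev q in q_neq0 *.
have [K cK] := shorter_exists c; elim: K c cK cd r => [|K IH] c cK cd r qcr.
  by rewrite (shorter0 cK) !(lin0 (tmap_linear _)).
have [k q0k q0k_neq0] := top_length q_neq0.
pose top := mpart (fun s => size s == K) c.
have top_c s : s \in msupp top -> s \in msupp c by rewrite mem_mpart => /andP[].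
have killed t nus x : contract (fun w => (rho w)@_t) (contracts nus (tmap ev x)) = 0.
  have [nus' ->] := contracts_tmap ev nus x; rewrite contract_tmap.
  rewrite (_ : contract _ _ = 0) ?(lin0 (tmap_linear _)) //.
  apply: (@eq_linear _ _ _ (contract (fun w => pairing (fun w => (rho w)@_t) (ev w)))
                           (fun => 0)).
  - exact: contract_linear.
  - by move=> a u v; rewrite scaler0 addr0.
  case=> [|w s] _; first by rewrite contract1.
  rewrite contractU /pairing -(lin_mlin rho (ev w) (linear_mcoeff t)).
  by rewrite -lin_extE rho0 mcoeff0 scale0r.
have top_fixed : tmap (fun w => word F w - rho w) top = top.
  apply: tmap_fixed => t nus.
  have -> : contract (fun w => (word F w - (word F w - rho w))@_t) (contracts nus top) =
      contract (fun w => (rho w)@_t) (contracts nus top).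
    apply: (@eq_linear _ _ _ (contract _) (contract _)); try exact: contract_linear.
    case=> [|w s] _; first by rewrite !contract1.
    by rewrite !contractU subKr.
  apply: (contracts_ushuf_eq0 charF0 q0k_neq0) => nus'.
    by rewrite /q0 mpart_tmap killed.
  by rewrite -mpart_umul // qcr mpart_tmap killed.
have top_sg : top = tmap ev (tmap sg top).
  rewrite tmap_comp -[LHS]top_fixed; apply: eq_tmap => s /top_c sc t ts.
  by rewrite -bevalE; apply: rho_sg; apply: cd ts.
have rest : c - top = tmap ev (tmap sg (c - top)).
  apply: (IH _ _ _ (r - umul q (tmap sg top))).
  - move=> s; rewrite -mcoeff_neq0 mcoeffB mcoeff_mpart.
    case: (size s =P K) => [_|sK]; first by rewrite subrr eqxx.
    rewrite subr0 mcoeff_neq0 => /cK.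
    by rewrite ltnS leq_eqVlt => /orP[/eqP|].
  - by move=> s t /mem_msuppB /orP[|/top_c]; apply: cd.
  rewrite (linB (umul_linearr _)) (linB (tmap_linear _)) qcr tmap_umul -/q0.
  by rewrite -top_sg.
by rewrite -[LHS](subrK top) rest {2}top_sg -!(linD (tmap_linear _)) subrK.
Qed.

(** * Homogeneous pairs of dependent elements *)

Section Homogeneous.
Variables (F : fieldType) (N : nat).
Local Notation W := (bword N).
Local Notation B := (Br F N).
Local Notation wd := (@word F N).

Lemma mem_sum_words (t : W) (s : seq W) : t \in msupp (\sum_(w <- s) wd w) -> t \in s.
Proof.
by case/mem_msupp_sum => w ws; rewrite /word mem_msuppU => /eqP ->.
Qed.

Lemma mem_brace t (vs : seq B) v : t \in msupp (brace vs v) ->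
  exists us u, [/\ all2 (fun u (v : B) => u \in msupp v) us vs, u \in msupp v &
                   t \in bword_brace us u].
Proof.
case/mem_multilin_ext => us us_vs; rewrite lin_extE => /mem_msupp_mlin [u uv].
by move/mem_sum_words => tu; exists us, u.
Qed.

Lemma mem_uact t p (v : B) : t \in msupp (uact p v) ->
  exists s u, [/\ s \in msupp p, u \in msupp v & t \in bword_brace s u].
Proof.
case/mem_msupp_mlin => s sp; rewrite brace_words => /mem_msupp_mlin [u uv].
by move/mem_sum_words => tu; exists s, u.
Qed.

Lemma homog_uact d e p (v : B) :
  homogU d p -> homog (fun=> 1%N) e v -> homog (fun=> 1%N) (d + e) (uact p v).
Proof.
move=> pd ve t /mem_uact [s [u [/pd sd /ve ue /(wt_bword_brace (fun=> 1%N)) ->]]].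
by rewrite ue -sd.
Qed.

Lemma homog_sub om d (u v : B) : homog om d u -> homog om d v -> homog om d (u - v).
Proof. by move=> ud vd w /mem_msuppB /orP[/ud|/vd]. Qed.

Variables (M : nat) (f : 'I_M -> B) (om : 'I_M -> nat) (om' : 'I_N -> nat).
Hypothesis f_hom : forall i, homog om' (om i) (f i).

Lemma homog_eval w : homog om' (wt om w) (bword_eval f w).
Proof.
elim/bword_eq_ind: w => x us IH t /= /mem_brace [s [u [s_us u_fx]]].
move/(wt_bword_brace om') => ->; rewrite wt_BWord addnC (f_hom u_fx); congr addn.
rewrite /wts; elim: us s IH s_us => [|v us IHus] [|w s] IH //=.
  by rewrite !big_nil.
case/andP => wv s_us; rewrite !big_cons (IH _ (mem_head _ _) _ wv); congr addn.
by apply: IHus => // v' us_v'; apply: IH; rewrite inE us_v' orbT.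
Qed.

Lemma homog_beval d P : homog om d P -> homog om' d (beval f P).
Proof.
move=> Pd t; rewrite bevalE lin_extE => /mem_msupp_mlin [w wP /homog_eval ->].
exact: Pd.
Qed.

End Homogeneous.

Lemma finitely_many_words M d :
  exists ws : seq (bword M), forall w, (deg w <= d)%N -> w \in ws.
Proof.
elim: d => [|d [ws wsP]].
  by exists [::] => w; have := deg_gt0 w; case: (deg w).
pose seqs n : seq (seq (bword M)) :=
  iter n (fun ss => [::] :: [seq u :: s | u <- ws, s <- ss]) [:: [::]].
have seqsP n s : (degs s <= d)%N -> (size s <= n)%N -> s \in seqs n.
  elim: n s => [|n IH] [|u s] //= s_d; rewrite ?mem_head // ltnS => s_n.
  rewrite inE; apply/allpairsP; exists (u, s); move: s_d.
  rewrite /degs wts_cons -/(deg u) -/(degs s) => s_d.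
  split=> //=; [apply: wsP | apply: IH => //]; lia.
exists [seq BWord x us | x <- enum 'I_M, us <- seqs d] => -[x us].
rewrite /deg wt_BWord -/(degs us) add1n ltnS => us_d.
apply/allpairsP; exists (x, us); rewrite mem_enum; split=> //=.
apply: seqsP => //; apply: leq_trans us_d.
elim: us => //= u us IH; rewrite /degs wts_cons -/(degs us).
by have := deg_gt0 u; rewrite -/(deg u); lia.
Qed.

Section Relations.
Variables (F : fieldType) (M N : nat) (f : 'I_M -> Br F N).
Local Notation ev := (bword_eval f).
Local Notation E := (beval f).

(** A relation of minimal degree has coefficients that do not vanish on the
    [f i]: otherwise the entries of the words in such a coefficient would
    satisfy a relation of smaller degree. *)
Lemma reduced_relation (P : Br F M) : P != 0 -> E P = 0 ->
  exists P', E P' = 0 /\ exists x, tmap ev (croot x P') != 0.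
Proof.
have [d Pd] : exists d, {in msupp P, forall w, (deg w <= d)%N}.
  exists (\max_(w <- msupp P) deg w)%N => w wP.
  exact: (leq_bigmax_seq (F := @deg M)).
elim: d P Pd => [|d IH] P Pd P_neq0 P0.
  case/mcoeff_neq0P: P_neq0 => w; rewrite mcoeff_neq0 => /Pd.
  by have := deg_gt0 w; case: (deg w).
case: (pickP (fun x => tmap ev (croot x P) != 0)) => [x Px|Px0].
  by exists P; split=> //; exists x.
case/mcoeff_neq0P: P_neq0 => -[x us]; rewrite -mcoeff_croot mcoeff_neq0 => x_us.
set p := croot x P in x_us.
pose ws := flatten (msupp p : seq _).
have ws_d w : w \in ws -> (deg w <= d)%N.
  case/flattenP => s sp ws_s.
  have : BWord x s \in msupp P by rewrite -mcoeff_neq0 -mcoeff_croot mcoeff_neq0.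
  move/Pd; rewrite /deg wt_BWord -/(deg w) add1n ltnS; apply: leq_trans.
  by rewrite /wts (perm_big _ (perm_to_rem ws_s)) big_cons leq_addr.
have lin_E : linear E by exact: eval_linear.
have [sg [lin_sg sg_ws sgK]] := quasi_inverse ws lin_E.
have [/allP fixed|/allPn [w w_ws w_neq]] :=
    boolP (all (fun w => sg (E << w >>) == << w >>) ws); last first.
  apply: (IH (<< w >> - sg (E << w >>))).
  - move=> u /mem_msuppB /orP[|/sg_ws]; last exact: ws_d.
    by rewrite mem_msuppU => /eqP ->; apply: ws_d.
  - by rewrite subr_eq0 eq_sym.
  by rewrite (linB lin_E) sgK // subrr.
have: tmap (fun t => sg << t >>) (tmap ev p) = p.
  rewrite tmap_comp -[RHS]mlin_id; apply: (@eq_linear _ _ _ (tmap _)).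
  - exact: tmap_linear.
  - exact: mlin_linear.
  move=> s sp; rewrite mlinU tmapU -[RHS]tens_words; congr tens.
  apply/eq_in_map => w ws_s.
  have w_ws : w \in ws by apply/flattenP; exists s.
  rewrite /word -(eqP (fixed _ w_ws)) eval_word lin_extE.
  by rewrite -[in RHS](mlin_id (ev w)) (lin_mlin _ _ lin_sg).
move/negbT: (Px0 x); rewrite negbK => /eqP ->.
rewrite (lin0 (tmap_linear _)) => p0.
by move: x_us; rewrite -p0 mem_msupp0.
Qed.

End Relations.

Lemma ord2_cases (i j k : 'I_2) : i != j -> k != i -> k = j.
Proof.
move=> ij ki; apply: val_inj; move: ij ki; rewrite -!val_eqE /=.
by case: i j k => [[|[|i]] ?] [[|[|j]] ?] [[|[|k]] ?].
Qed.

(** The weak algorithm turns the relation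
    [p * f i + q * f j = 0] into [p = - q * c], hence [f j = c * f i]; as [q]
    and [q * c] lie in the tensor algebra on the subalgebra generated by the
    [f k], so does [c]; and the degree of [c] is too small to involve [f j]. *)
Lemma dependent_pair (F : fieldType) N (f : 'I_2 -> Br F N) (i j : 'I_2)
    (om : 'I_2 -> nat) (P : Br F 2) :
  [pchar F] =i pred0 -> i != j ->
  (forall k, homog (fun=> 1%N) (om k) (f k)) -> f i != 0 ->
  (0 < om i)%N -> (om i <= om j)%N ->
  P != 0 -> beval f P = 0 ->
  exists2 Q, free_of j Q & f j = beval f Q.
Proof.
move=> charF0 ij f_hom fi_neq0 om_gt0 le_om P_neq0 /(reduced_relation P_neq0).
case=> {P_neq0} {}P [P0 [x px_neq0]]; set ev := bword_eval f in P0 px_neq0 *.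
have ji : j != i by rewrite eq_sym.
pose p k := tmap ev (croot k P).
have rel : uact (p i) (f i) + uact (p j) (f j) = 0.
  rewrite -[RHS]P0 [P in RHS]sum_croot (lin_sum (eval_linear f)).
  under [RHS]eq_bigr do rewrite eval_uact eval_gen.
  rewrite (bigD1 i) //= (bigD1 j) //= big1 ?addr0 // => k /andP[ki].
  by rewrite (ord2_cases ij ki) eqxx.
have pj_neq0 : p j != 0.
  apply/eqP => pj0; case/eqP: px_neq0; rewrite -/(p x).
  have [->|xi] := eqVneq x i; last by rewrite (ord2_cases ij xi).
  apply: (uact_eq0 (f_hom i)) fi_neq0.
  by move: rel; rewrite pj0 (lin0 (uact_linearl _)) addr0.
have [y fiy] : exists y, croot y (f i) != 0.
  case/mcoeff_neq0P: fi_neq0 => -[y us]; rewrite -mcoeff_croot => fiy.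
  by exists y; apply/eqP => f0; rewrite f0 mcoeff0 eqxx in fiy.
have [||c c_hom pc] := @weak_algorithm F N (om i).-1 (om j).-1 (p i) (p j)
    (croot y (f i)) (croot y (f j)) (homog_croot (x := y) (f_hom i))
    (homog_croot (x := y) (f_hom j)) _ fiy pj_neq0.
- lia.
- by rewrite -!croot_uact -(linD (croot_linear y)) rel (lin0 (croot_linear y)).
have {}c_hom : homogU (om j - om i)%N c by move=> s /c_hom ->; lia.
have p_i : p i = - umul (p j) c by apply/eqP; rewrite -addr_eq0 pc.
have f_j : f j = uact c (f i).
  apply/eqP; rewrite -subr_eq0; apply/negPn/negP => fjc.
  case/negP: pj_neq0; apply/eqP; apply: (uact_eq0 (d := om j)) fjc.
    apply: homog_sub => //; have := homog_uact c_hom (f_hom i).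
    by rewrite subnK.
  rewrite (linB (uact_linearr _)) uact_umul -[umul _ _]opprK -p_i.
  by rewrite (linN (uact_linearl _)) opprK addrC.
pose d := (om j - om i)%N.
have [ws0 ws0P] := finitely_many_words 2 d.
pose ws := [seq w <- ws0 | j \notin letters w].
have [sg [lin_sg sg_ws sgK]] := quasi_inverse ws (eval_linear f).
(* Cutting off above degree [d] makes [rho] kill the evaluation of every word,
   since words of weight at most [d] are without [j] and thus belong to [ws]. *)
pose rho (t : bword N) : Br F N :=
  if (deg t <= d)%N then word F t - beval f (sg << t >>) else 0.
have rho0 w : lin_ext rho (ev w) = 0.
  rewrite lin_extE.
  have w_hom : homog (fun=> 1%N) (wt om w) (ev w) by apply: homog_eval.
  have [w_d|w_d] := leqP (wt om w) d; last first.
    rewrite -[RHS](@mlin0 F (bword N) (ev w)).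
    apply: eq_mlin => t /w_hom; rewrite /rho /deg => ->.
    by rewrite leqNgt w_d.
  have w_ws : w \in ws.
    have om_pos k : (0 < om k)%N.
      have [->//|ki] := eqVneq k i; rewrite (ord2_cases ij ki); lia.
    have deg_w : (deg w <= wt om w)%N by apply: leq_sum => k _.
    rewrite mem_filter ws0P ?(leq_trans deg_w) // andbT; apply/negP => jw.
    move: w_d; rewrite /wt (perm_big _ (perm_to_rem jw)) big_cons /d.
    by move/(leq_trans (leq_addr _ _)); lia.
  transitivity (ev w - beval f (sg (ev w))).
    rewrite -[in RHS](mlin_id (ev w)).
    have lin_r : linear (fun v => v - beval f (sg v)).
      apply: linear_sub => //; exact: linear_comp (eval_linear f) lin_sg.
    rewrite [RHS](lin_mlin _ _ lin_r); apply: eq_mlin => t /w_hom t_d.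
    by rewrite /rho /deg t_d w_d.
  by have := sgK w w_ws; rewrite eval_word => ->; rewrite subrr.
have rho_sg t : (deg t <= d)%N -> word F t - rho t = beval f (sg << t >>).
  by rewrite /rho => ->; rewrite subKr.
have c_deg s t : s \in msupp c -> t \in s -> (deg t <= d)%N.
  move/c_hom => sd ts; rewrite /d -sd /degs /wts (perm_big _ (perm_to_rem ts)) big_cons.
  exact: leq_addr.
have pj_c : umul (p j) c = tmap ev (- croot i P).
  by rewrite (linN (tmap_linear _)) -/(p i) p_i opprK.
have c_ev := tmap_descent charF0 rho0 rho_sg c_deg pj_neq0 pj_c.
set c' := tmap _ c in c_ev.
exists (uact c' (gen F i)); last by rewrite eval_uact eval_gen -c_ev.
apply/free_ofP => t /mem_uact [s [u [sc ui]]].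
move/(wt_bword_brace (fun k => (k == j) : nat)) => ->.
move: ui; rewrite /gen /word mem_msuppU => /eqP ->.
rewrite wt_BWord (negbTE ij) /wts big_nil !addn0.
case/mem_msupp_mlin: sc => r _ /mem_tens s_r; apply/eqP.
rewrite sum_nat_seq_eq0; apply/allP => w s_w; rewrite /= wt_letter_eq0.
have : w \in ws.
  elim: r s s_r s_w => [|v r IH] [|w' s] //= /andP[wv /IH {}IH].
  by rewrite inE => /orP[/eqP ->|//]; apply: sg_ws wv.
by rewrite mem_filter => /andP[].
Qed.

(** * Degrees and leading parts *)

Definition dg F N (v : Br F N) : nat := \max_(w <- msupp v) deg w.

HB.lock Definition lead F N (v : Br F N) : Br F N :=
  mpart (fun w => deg w == dg v) v.

Section Degree.
Variables (F : fieldType) (N : nat).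
Local Notation B := (Br F N).

Lemma leq_dg (v : B) w : w \in msupp v -> (deg w <= dg v)%N.
Proof. by move=> vw; apply: (leq_bigmax_seq (F := @deg N)). Qed.

Lemma dg_leq (v : B) n : {in msupp v, forall w, (deg w <= n)%N} -> (dg v <= n)%N.
Proof. by move=> vn; apply/bigmax_leqP_seq => w /vn. Qed.

Lemma dg_lt (v : B) n : (0 < n)%N ->
  {in msupp v, forall w, (deg w < n)%N} -> (dg v < n)%N.
Proof. by case: n => // n _ vn; rewrite ltnS; apply: dg_leq. Qed.

Lemma dg_gt0 (v : B) : v != 0 -> (0 < dg v)%N.
Proof.
case/mcoeff_neq0P => w; rewrite mcoeff_neq0 => /leq_dg.
by apply: leq_trans; apply: deg_gt0.
Qed.

Lemma dg_add (u v : B) n : (dg u <= n)%N -> (dg v <= n)%N -> (dg (u + v)%R <= n)%N.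
Proof.
move=> un vn; apply: dg_leq => w /mem_msuppD /orP[] /leq_dg w_le; exact: leq_trans w_le _.
Qed.

Lemma dg_brace (vs : seq B) v : (dg (brace vs v) <= \sum_(u <- vs) dg u + dg v)%N.
Proof.
apply: dg_leq => t /mem_brace [us [u [us_vs /leq_dg uv]]].
move/(wt_bword_brace (fun=> 1%N)) => tE; rewrite /deg tE -/(deg u).
apply: leq_add => //; rewrite /wts.
elim: vs us us_vs {tE} => [|v' vs IH] [|w us] //=; first by rewrite !big_nil.
by case/andP => /leq_dg wv /IH; rewrite !big_cons; apply: leq_add.
Qed.

Lemma mcoeff_lead (v : B) w : (lead v)@_w = if deg w == dg v then v@_w else 0.
Proof. by rewrite unlock mcoeff_mpart. Qed.

Lemma lead_homog (v : B) : homog (fun=> 1%N) (dg v) (lead v).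
Proof. by move=> w; rewrite unlock mem_mpart => /andP[/eqP]. Qed.

Lemma dg_lead (v : B) : (dg (lead v) <= dg v)%N.
Proof. by apply: dg_leq => w /lead_homog <-. Qed.

Lemma dg_sub_lead (v : B) : v != 0 -> (dg (v - lead v)%R < dg v)%N.
Proof.
move=> v_neq0; apply: dg_lt; first exact: dg_gt0.
move=> w; rewrite -mcoeff_neq0 mcoeffB mcoeff_lead.
case: (deg w =P dg v) => [_|/eqP w_neq]; first by rewrite subrr eqxx.
by rewrite subr0 mcoeff_neq0 ltn_neqAle w_neq => /leq_dg.
Qed.

Lemma lead_neq0 (v : B) : v != 0 -> lead v != 0.
Proof.
move=> v_neq0; apply/eqP => v0; have := dg_sub_lead v_neq0.
by rewrite v0 subr0 ltnn.
Qed.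

End Degree.

Section LeadEval.
Variables (F : fieldType) (M N : nat) (f : 'I_M -> Br F N).
Hypothesis f_neq0 : forall k, f k != 0.

Let g k := lead (f k).
Let om k := dg (f k).

Lemma om_gt0 k : (0 < om k)%N. Proof. exact: dg_gt0. Qed.

Lemma dg_homog (v : Br F N) n : homog (fun=> 1%N) n v -> (dg v <= n)%N.
Proof. by move=> vn; apply: dg_leq => w /vn <-. Qed.

Lemma lead_eval_homog w : homog (fun=> 1%N) (wt om w) (bword_eval g w).
Proof. by apply: homog_eval => i; apply: lead_homog. Qed.

(** Leading parts are multilinear: replace the entries [h1 u] by [h2 u] one at a
    time, each replacement costing only terms of lower degree; [s] collects the
    entries already replaced. *)
Lemma dg_sub_brace (h1 h2 : bword M -> Br F N) (mu : bword M -> nat) us s a b n :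
  {in us, forall u, [/\ dg (h1 u) <= mu u, dg (h2 u) <= mu u &
                        dg (h1 u - h2 u)%R < mu u]%N} ->
  (dg a <= n)%N -> (dg b <= n)%N -> (dg (a - b)%R < n)%N ->
  (dg (brace (s ++ map h1 us) a - brace (s ++ map h2 us) b)%R <
   \sum_(v <- s) dg v + (\sum_(u <- us) mu u + n))%N.
Proof.
elim: us s => [|u us IH] s h12 an bn abn.
  rewrite /= !cats0 -(linB (brace_linearr s)) big_nil add0n.
  by apply: leq_ltn_trans (dg_brace _ _) _; rewrite ltn_add2l.
have [h1u h2u h12u] := h12 u (mem_head _ _).
have {}h12 : {in us, forall u, [/\ dg (h1 u) <= mu u, dg (h2 u) <= mu u &
                        dg (h1 u - h2 u)%R < mu u]%N}.
  by move=> v us_v; apply: h12; rewrite inE us_v orbT.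
have -> : brace (s ++ map h1 (u :: us)) a - brace (s ++ map h2 (u :: us)) b =
    brace (s ++ (h1 u - h2 u) :: map h1 us) a +
    (brace (rcons s (h2 u) ++ map h1 us) a - brace (rcons s (h2 u) ++ map h2 us) b).
  by rewrite (linB (brace_linearl s _ a)) !cat_rcons addrA subrK.
have pos : (0 < \sum_(v <- s) dg v + (\sum_(v <- u :: us) mu v + n))%N by lia.
case E : (_ + _)%N pos => [//|m] _; rewrite ltnS.
apply: dg_add; rewrite -ltnS -E.
  apply: leq_ltn_trans (dg_brace _ _) _.
  rewrite big_cat /= !big_cons big_map -addnA ltn_add2l.
  have : (\sum_(v <- us) dg (h1 v) <= \sum_(v <- us) mu v)%N.
    by rewrite big_seq [leqRHS]big_seq; apply: leq_sum => v /h12 [].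
  move=> le_us; apply: leq_ltn_trans (leq_add (leq_add (leqnn _) le_us) an) _.
  by rewrite !ltn_add2r.
apply: leq_trans (IH (rcons s (h2 u)) h12 an bn abn) _.
by rewrite big_rcons big_cons /= -!addnA leq_add2l leq_add2r.
Qed.

Lemma dg_eval w :
  [/\ dg (bword_eval f w) <= wt om w, dg (bword_eval g w) <= wt om w &
      dg (bword_eval f w - bword_eval g w)%R < wt om w]%N.
Proof.
elim/bword_eq_ind: w => x us IH.
have lt_x : (dg (bword_eval f (BWord x us) - bword_eval g (BWord x us))%R <
             wt om (BWord x us))%N.
  have := @dg_sub_brace (bword_eval f) (bword_eval g) (wt om) us [::] (f x) (g x)
    (om x) IH (leqnn _) (dg_lead _) (dg_sub_lead (f_neq0 x)).
  by rewrite big_nil add0n wt_BWord addnC.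
have le_g : (dg (bword_eval g (BWord x us)) <= wt om (BWord x us))%N.
  exact: dg_homog (@lead_eval_homog _).
split; [| exact: le_g | exact: lt_x].
rewrite -(subrK (bword_eval g (BWord x us)) (bword_eval f (BWord x us))).
by apply: dg_add le_g; apply: ltnW.
Qed.

(** By [dg_eval], words of weight less than [D] do not reach the degree [D], and
    passing to the leading parts changes the value of a word of weight [D] in
    lower degrees only. *)
Lemma mcoeff_eval_lead P D t :
  {in msupp P, forall w, (wt om w <= D)%N} -> deg t = D ->
  (beval f P)@_t =
  (beval g (mpart (fun w => wt om w == D) P))@_t.
Proof.
move: (eval_linear f) (eval_word f) (eval_linear g) (eval_word g).
move: (beval f) (beval g) => Ef Eg lin_f fE lin_g gE.
move=> PD tD; apply/eqP; rewrite -subr_eq0 -mcoeffB.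
suff -> : (Ef P -
    Eg (mpart (fun w => wt om w == D) P))@_t = 0 by [].
have lin_d : linear (fun P => Ef P -
    Eg (mpart (fun w => wt om w == D) P)).
  apply: linear_sub lin_f _.
  exact: linear_comp lin_g (mpart_linear _).
apply: (@eq_linear _ _ F^o (fun P => (Ef P -
    Eg (mpart (fun w => wt om w == D) P))@_t) (fun=> 0)).
- exact: linear_comp (linear_mcoeff t) lin_d.
- by move=> a u v; rewrite scaler0 addr0.
move=> w /PD w_D; rewrite mpartU fE.
have [f_w _ fg_w] := dg_eval w.
case: eqP => [wD|/eqP w_neq]; first rewrite gE.
  apply: mcoeff_outdom; apply/negP => /leq_dg t_le.
  by have := leq_ltn_trans t_le fg_w; rewrite wD tD ltnn.
rewrite (lin0 lin_g) subr0; apply: mcoeff_outdom; apply/negP => /leq_dg t_le.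
by have := leq_trans t_le f_w; rewrite tD leqNgt ltn_neqAle w_neq w_D.
Qed.

End LeadEval.

(** * Elementary automorphisms *)

HB.lock Definition elem (F : fieldType) M (i : 'I_M) (a : F) (h : Br F M) :
    Br F M -> Br F M :=
  beval (fun k => if k == i then a *: gen F i + h else gen F k).

Section Elementary.
Variables (F : fieldType) (M : nat).
Local Notation B := (Br F M).
Implicit Types (phi psi : B -> B).

Lemma eval_is_morphism N (f : 'I_M -> Br F N) :
  brace_morphism (beval f).
Proof. by split; [apply: eval_linear | apply: eval_brace]. Qed.

Lemma morphism_eq phi psi : brace_morphism phi -> brace_morphism psi ->
  (forall i, phi (gen F i) = psi (gen F i)) -> phi =1 psi.
Proof.
move=> m_phi m_psi eq_gen v.
have [chi _ uniq_chi] := Br_free (fun i => psi (gen F i)).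
rewrite (uniq_chi phi m_phi eq_gen); apply/esym.
exact: (uniq_chi psi m_psi (fun=> erefl)).
Qed.

Lemma morphism_eval phi : brace_morphism phi ->
  phi =1 beval (fun i => phi (gen F i)).
Proof.
move=> m_phi; apply: (morphism_eq m_phi (eval_is_morphism _)) => i.
by rewrite eval_gen.
Qed.

Lemma morphism_comp phi psi :
  brace_morphism phi -> brace_morphism psi -> brace_morphism (phi \o psi).
Proof.
move=> [lin_phi phiM] [lin_psi psiM]; split=> [|s a /=].
  exact: linear_comp lin_phi lin_psi.
by rewrite psiM phiM -map_comp.
Qed.

Lemma automorphism_comp phi psi :
  brace_automorphism phi -> brace_automorphism psi -> brace_automorphism (phi \o psi).
Proof.
move=> [m_phi b_phi] [m_psi b_psi]; split; first exact: morphism_comp.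
exact: bij_comp.
Qed.

Lemma elem_is_morphism i a (h : B) : brace_morphism (elem i a h).
Proof. by rewrite unlock; apply: eval_is_morphism. Qed.

Lemma elem_linear i a (h : B) : linear (elem i a h).
Proof. by have [] := elem_is_morphism i a h. Qed.

Lemma elem_gen i a (h : B) : elem i a h (gen F i) = a *: gen F i + h.
Proof. by rewrite unlock eval_gen eqxx. Qed.

Lemma elem_gen_neq i a (h : B) k : k != i -> elem i a h (gen F k) = gen F k.
Proof. by move=> ki; rewrite unlock eval_gen (negbTE ki). Qed.

Lemma elem_free i a (h u : B) : free_of i u -> elem i a h u = u.
Proof.
move=> u_free; apply: (@eq_linear _ _ _ (elem i a h) (fun u => u)) => //.
  exact: elem_linear.
move=> w /u_free; rewrite unlock eval_word.
elim/bword_eq_ind: w => x us IH /=; rewrite inE negb_or => /andP[ix i_us].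
rewrite eq_sym (negbTE ix) -[RHS]brace_gen; congr (brace _ _).
apply/eq_in_map => w us_w; apply: IH => //; apply: contra i_us => iw.
by apply/flattenP; exists (letters w) => //; apply: map_f.
Qed.

Lemma free_of_scale i a (h : B) : free_of i h -> free_of i (a *: h).
Proof. by move=> h_free w /mem_msuppZ /h_free. Qed.

Lemma elemK i a b (h : B) : a * b = 1 -> free_of i h ->
  cancel (elem i b (- b *: h)) (elem i a h).
Proof.
move=> ab h_free v.
apply: (morphism_eq (phi := elem i a h \o elem i b (- b *: h)) (psi := id)) => //.
  by apply: morphism_comp; apply: elem_is_morphism.
  by split=> // s u; rewrite map_id.
move=> k /=; have [->|ki] := eqVneq k i; last by rewrite !elem_gen_neq.
have lin_e := elem_linear i a h.
rewrite (elem_gen i b).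
rewrite (linD lin_e (b *: gen F i) (- b *: h)).
transitivity (b *: (a *: gen F i + h) + - b *: h).
  congr (_ + _); first by rewrite -(elem_gen i a h); apply: linZ.
  by apply: elem_free; apply: free_of_scale.
by rewrite scalerDr scalerA mulrC ab scale1r scaleNr addrK.
Qed.

Lemma elemVK i a (h : B) : a != 0 -> free_of i h ->
  cancel (elem i a h) (elem i a^-1 (- a^-1 *: h)).
Proof.
move=> a_neq0 h_free; have := @elemK i a^-1 a (- a^-1 *: h) (mulVf a_neq0).
rewrite scalerA mulrNN mulfV // scale1r; apply; exact: free_of_scale.
Qed.

Lemma elem_elementary i a (h : B) : a != 0 -> free_of i h -> elementary (elem i a h).
Proof.
move=> a_neq0 h_free; split.
  split; first exact: elem_is_morphism.
  exists (elem i a^-1 (- a^-1 *: h)); first exact: elemVK.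
  by apply: elemK => //; rewrite mulfV.
exists i; split=> [k|]; first exact: elem_gen_neq.
by exists a, h; rewrite elem_gen.
Qed.

Lemma tame_id phi : phi =1 id -> tame phi.
Proof.
move=> phi_id; exists 0%N, (fun _ => id); split=> [[]//|v].
by rewrite phi_id big_ord0.
Qed.

Lemma tame_comp phi psi chi :
  tame phi -> elementary psi -> chi =1 phi \o psi -> tame chi.
Proof.
move=> [n [p [p_el phiE]]] psi_el chiE.
pose q (k : 'I_n.+1) := if unlift ord_max k is Some k' then p k' else psi.
exists n.+1, q; split=> [k|v]; first by rewrite /q; case: (unlift _ _).
(* Composition is a monoid law, so the last factor can be split off. *)
pose comp_law : Monoid.law (id : B -> B) := HB.pack (fun g h : B -> B => g \o h)
  (Monoid.isLaw.Build (B -> B) id (fun g h : B -> B => g \o h)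
     (fun _ _ _ => erefl) (fun _ => erefl) (fun _ => erefl)).
have -> : \big[(fun g h : B -> B => g \o h)/id]_(k < n.+1) q k =
    (\big[(fun g h : B -> B => g \o h)/id]_(k < n) q (widen_ord (leqnSn n) k))
      \o q ord_max.
  exact: (@big_ord_recr _ _ comp_law).
have -> : \big[(fun g h : B -> B => g \o h)/id]_(k < n) q (widen_ord (leqnSn n) k) =
    \big[(fun g h : B -> B => g \o h)/id]_(k < n) p k.
  apply: eq_bigr => k _; rewrite /q.
  have -> : widen_ord (leqnSn n) k = lift ord_max k by apply/val_inj/esym/lift_max.
  by rewrite liftK.
by rewrite chiE /= phiE /q unlift_none.
Qed.

(** The inverse of an elementary automorphism is elementary. *)
Lemma tame_elem phi i a (h : B) : a != 0 -> free_of i h ->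
  tame (phi \o elem i a h) -> tame phi.
Proof.
move=> a_neq0 h_free tame_phi.
apply: (tame_comp tame_phi (psi := elem i a^-1 (- a^-1 *: h))).
  by apply: elem_elementary; [rewrite invr_eq0 | apply: free_of_scale].
by move=> v /=; rewrite elemK // mulfV.
Qed.

Lemma automorphism_elem phi i a (h : B) : a != 0 -> free_of i h ->
  brace_automorphism phi -> brace_automorphism (phi \o elem i a h).
Proof.
move=> a_neq0 h_free aut_phi; apply: automorphism_comp => //.
by have [] := elem_elementary a_neq0 h_free.
Qed.

End Elementary.

(** * Automorphisms in two generators *)

Section TwoGenerators.
Variable F : fieldType.
Local Notation B := (Br F 2).
Implicit Types (phi : B -> B) (i j k : 'I_2).
Local Notation g := (gen F).

Lemma mcoeff_gen i k us : (g i)@_(BWord k us) = ((i == k) && (us == [::]))%:R.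
Proof.
rewrite /gen /word mcoeffU; congr (_ *+ nat_of_bool _).
by apply/eqP/andP => [[-> <-]|[/eqP -> /eqP ->]].
Qed.

Lemma mcoeff_letter (c : F) i k :
  (c *: g i)@_(BWord k [::]) = if i == k then c else 0.
Proof.
by rewrite mcoeffZ mcoeff_gen eqxx andbT; case: (i == k); rewrite ?mulr1 ?mulr0.
Qed.

Lemma gen_neq0 i : g i != 0.
Proof.
apply/eqP => g0; have := mcoeff_gen i i [::].
by rewrite g0 mcoeff0 !eqxx => /esym/eqP; rewrite oner_eq0.
Qed.

Lemma free_of_gen i j : i != j -> free_of j (g i).
Proof.
move=> ij w; rewrite /gen /word mem_msuppU => /eqP -> /=.
by rewrite inE eq_sym.
Qed.

Lemma linear_form i j (v : B) : i != j -> (dg v <= 1)%N ->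
  v = v@_(BWord i [::]) *: g i + v@_(BWord j [::]) *: g j.
Proof.
move=> ij v1.
have v_homog : homog (fun=> 1%N) 1 v.
  move=> w /leq_dg w_v; apply/eqP; rewrite eqn_leq (leq_trans w_v v1).
  exact: deg_gt0.
have v_x x : uact (croot x v) (g x) = v@_(BWord x [::]) *: g x.
  rewrite (homogU0_scalar (homog_croot (x := x) v_homog)) mcoeff_croot.
  rewrite (linZ (uact_linearl _)); congr (_ *: _).
  by rewrite uactUl; apply: brace_nil.
have sum_v : v = uact (croot i v) (g i) + uact (croot j v) (g j).
  rewrite {1}[v]sum_croot (bigD1 i) //= (bigD1 j) 1?eq_sym //= big1 => [|k /andP[ki]].
    by congr (_ + _); apply: addr0.
  by rewrite (ord2_cases ij ki) eqxx.
by rewrite {1}sum_v; congr (_ + _); [apply: (v_x i) | apply: (v_x j)].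
Qed.

Lemma automorphism_neq0 phi v : brace_automorphism phi -> v != 0 -> phi v != 0.
Proof.
move=> [[lin_phi _] /bij_inj inj_phi] v_neq0; apply/eqP => phi_v0.
by case/eqP: v_neq0; apply: inj_phi; rewrite phi_v0 (lin0 lin_phi).
Qed.

(** The generators are themselves polynomials in the [phi (g k)]. If such a
    polynomial has weight at least 2, its part of greatest weight is a relation
    between the leading parts; if none does, both generators are multiples of
    the same [phi (g i)]. *)
Lemma lead_relation phi i j : brace_automorphism phi -> i != j ->
  (1 < dg (phi (g j)))%N ->
  exists2 P, P != 0 & beval (fun k => lead (phi (g k))) P = 0.
Proof.
move=> aut_phi ij j_gt1; have [m_phi [chi chiK phiK]] := aut_phi.
pose f k := phi (g k); pose om k := dg (f k).
have f_neq0 k : f k != 0 by apply: automorphism_neq0 (gen_neq0 k).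
have phiE : phi =1 beval f by apply: morphism_eval.
pose D k := \max_(w <- msupp (chi (g k))) wt om w.
have D_max k w : w \in msupp (chi (g k)) -> (wt om w <= D k)%N.
  by move=> w_k; apply: (leq_bigmax_seq (F := wt om)).
case: (pickP (fun k => 1 < D k)%N) => [k k_gt1|D_le1].
  pose P := mpart (fun w => wt om w == D k) (chi (g k)); exists P.
    apply/eqP => P0; have: (D k <= (D k).-1)%N.
      apply/bigmax_leqP_seq => w w_k _; have := D_max k w w_k.
      rewrite leq_eqVlt => /orP[w_D|]; last by move: k_gt1; lia.
      suff: w \in msupp P by rewrite P0 mem_msupp0.
      by rewrite mem_mpart w_D.
    by move: k_gt1; lia.
  have P_homog : homog om (D k) P by move=> w; rewrite mem_mpart => /andP[/eqP].
  apply/malgP => t; rewrite mcoeff0.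
  have [t_D|t_D] := eqVneq (deg t) (D k).
    rewrite -(mcoeff_eval_lead f_neq0 (D_max k) t_D) -phiE phiK.
    case: t t_D => x us; rewrite mcoeff_gen => t_D.
    case: eqP => [_|//]; case: eqP => [us0|//]; move: t_D k_gt1.
    by rewrite us0 /deg wt_BWord /wts big_nil => <-.
  have gP_homog : homog (fun=> 1%N) (D k) (beval (fun k => lead (phi (g k))) P).
    by apply: homog_beval P_homog => k'; apply: lead_homog.
  by apply: mcoeff_outdom; apply: contra t_D => /gP_homog <-.
have chi_i k : chi (g k) = (chi (g k))@_(BWord i [::]) *: g i.
  apply/malgP => -[x us]; rewrite mcoeffZ mcoeff_gen.
  have [/andP[/eqP <- /eqP ->]|x_us] := boolP ((i == x) && (us == [::])).
    by rewrite mulr1.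
  rewrite mulr0 mcoeff_outdom //; apply/negP => /D_max.
  move/leq_trans/(_ (_ : D k <= 1)%N); rewrite leqNgt D_le1 => /(_ isT).
  have om_x : (0 < om x)%N by apply: dg_gt0.
  rewrite wt_BWord; case: us x_us => [|u us].
    rewrite eqxx andbT => ix; have -> : x = j by apply: (ord2_cases ij); rewrite eq_sym.
    by rewrite /wts big_nil addn0 leqNgt j_gt1.
  case: u => y us' _; rewrite wts_cons wt_BWord.
  have om_y : (0 < om y)%N by apply: dg_gt0.
  by move: om_x om_y; lia.
have lin_phi := m_phi.1.
pose a k := (chi (g k))@_(BWord i [::]).
have f_i k : a k *: f i = g k.
  by rewrite -[RHS]phiK [in RHS]chi_i (linZ lin_phi).
have swap (u v w : B) (c d : F) : c *: w = u -> d *: w = v -> c *: v = d *: u.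
  by move=> <- <-; rewrite !scalerA mulrC.
have ga : a i *: g j = a j *: g i by apply: swap (f_i i) (f_i j).
have a_i0 : a i = 0.
  transitivity ((a i *: g j)@_(BWord j [::])); first by rewrite mcoeff_letter eqxx.
  by rewrite ga mcoeff_letter (negbTE ij).
have g_i0 : g i = 0 by rewrite -[LHS](f_i i) a_i0 scale0r.
by case/eqP: (gen_neq0 i).
Qed.

(** One step of Euclidean reduction of the pair [phi (g i), phi (g j)]. *)
Lemma degree_reduction phi i j : [pchar F] =i pred0 ->
  brace_automorphism phi -> i != j ->
  (dg (phi (g i)) <= dg (phi (g j)))%N -> (1 < dg (phi (g j)))%N ->
  exists2 h, free_of j h & (dg (phi (g j) - phi h)%R < dg (phi (g j)))%N.
Proof.
move=> charF0 aut_phi ij le_ij j_gt1.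
have [P P_neq0 P0] := lead_relation aut_phi ij j_gt1.
pose f k := phi (g k); pose om k := dg (f k); pose fl k := lead (f k).
have f_neq0 k : f k != 0 by apply: automorphism_neq0 (gen_neq0 k).
have fl_homog k : homog (fun=> 1%N) (om k) (fl k) by apply: lead_homog.
have [Q Q_free Q_fl] := dependent_pair charF0 ij fl_homog (lead_neq0 (f_neq0 i))
  (dg_gt0 (f_neq0 i)) le_ij P_neq0 P0.
pose h := mpart (fun w => wt om w == om j) Q; exists h.
  by move=> w; rewrite mem_mpart => /andP[_ /Q_free].
have phiE : phi h = beval f h by apply: morphism_eval aut_phi.1 h.
have h_homog : homog om (om j) h by move=> w; rewrite mem_mpart => /andP[/eqP].
have h_le : {in msupp h, forall w, (wt om w <= om j)%N}.
  by move=> w /h_homog ->; apply: leqnn.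
apply: dg_lt => [|t t_fh]; first exact: ltnW.
have t_le : (deg t <= om j)%N.
  case/mem_msuppB/orP: t_fh => [|]; first exact: leq_dg.
  rewrite phiE bevalE lin_extE => /mem_msupp_mlin [w /h_homog <- /leq_dg t_w].
  apply: leq_trans t_w _; have [le_w _ _] := dg_eval f_neq0 w; exact: le_w.
rewrite ltn_neqAle; apply/andP; split; last exact: t_le.
apply/negP => /eqP t_j.
move: t_fh; rewrite -mcoeff_neq0 mcoeffB phiE.
rewrite (mcoeff_eval_lead f_neq0 h_le t_j) (mpart_id (P := fun w => wt om w == om j));
  last by move=> w /h_homog ->; apply: eqxx.
have -> : (phi (g j))@_t = (beval fl h)@_t.
  transitivity ((lead (f j))@_t); first by rewrite mcoeff_lead t_j eqxx.
  rewrite -/(fl j) Q_fl; apply/eqP; rewrite -subr_eq0 -mcoeffB.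
  rewrite -(linB (eval_linear fl)); apply/eqP/mcoeff_outdom/negP.
  rewrite bevalE lin_extE => /mem_msupp_mlin [w w_Qh].
  move/(homog_eval fl_homog) => t_w; move: w_Qh.
  rewrite -mcoeff_neq0 mcoeffB mcoeff_mpart -t_w -/(deg t) t_j eqxx subrr.
  by rewrite eqxx.
by rewrite subrr eqxx.
Qed.

(** Row reduction with a nonzero pivot: clear the entry below it, normalize the
    second row; what remains is elementary. *)
Lemma linear_tame_diag phi i j : brace_automorphism phi -> i != j ->
  (forall k, (dg (phi (g k)) <= 1)%N) -> (phi (g i))@_(BWord i [::]) != 0 ->
  tame phi.
Proof.
move=> aut_phi ij phi1 a_neq0; set a := (phi (g i))@_(BWord i [::]) in a_neq0.
pose c := - ((phi (g j))@_(BWord i [::]) / a).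
have ci_free : free_of j (c *: g i) by apply/free_of_scale/free_of_gen.
apply: (tame_elem (oner_neq0 F) ci_free).
set psi := phi \o _.
have aut_psi : brace_automorphism psi by apply: automorphism_elem => //; apply: oner_neq0.
have lin_phi := aut_phi.1.1.
have psi_i : psi (g i) = phi (g i) by rewrite /psi /= elem_gen_neq.
have psi_j0 : psi (g j) = phi (g j) + c *: phi (g i).
  by rewrite /psi /= elem_gen (linD lin_phi) scale1r (linZ lin_phi).
have psi_1 : (dg (psi (g j)) <= 1)%N.
  rewrite psi_j0; apply: dg_add; first exact: phi1.
  apply: dg_leq => w /mem_msuppZ /leq_dg w_le; exact: leq_trans w_le (phi1 i).
have psi_ji : (psi (g j))@_(BWord i [::]) = 0.
  transitivity ((phi (g j))@_(BWord i [::]) + c * a).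
    by rewrite psi_j0 mcoeffD; congr (_ + _); apply: mcoeffZ.
  by rewrite /c mulNr divfK // subrr.
have psi_j : psi (g j) = (psi (g j))@_(BWord j [::]) *: g j.
  by rewrite {1}(linear_form ij psi_1) psi_ji scale0r; apply: add0r.
set b := (psi (g j))@_(BWord j [::]) in psi_j.
have b_neq0 : b != 0.
  have := automorphism_neq0 aut_psi (gen_neq0 j); rewrite psi_j.
  by apply: contra => /eqP ->; rewrite scale0r.
have free0 : free_of j (0 : B) by move=> w; rewrite mem_msupp0.
have bV_neq0 : b^-1 != 0 by rewrite invr_eq0.
apply: (tame_elem bV_neq0 free0).
set chi := psi \o _.
have chi_i : chi (g i) = a *: g i + (phi (g i))@_(BWord j [::]) *: g j.
  rewrite /chi /= (elem_gen_neq _ _ ij) psi_i; exact: (linear_form ij (phi1 i)).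
have chi_j : chi (g j) = g j.
  transitivity (psi (b^-1 *: g j)).
    by rewrite /chi /= elem_gen; congr (psi _); apply: addr0.
  rewrite (linZ aut_psi.1.1) psi_j [LHS]scalerA (mulVf b_neq0); exact: scale1r.
have chi_el : elementary chi.
  split; first by apply: automorphism_elem.
  exists i; split=> [k ki|]; first by rewrite (ord2_cases ij ki).
  exists a, ((phi (g i))@_(BWord j [::]) *: g j).
  split; [exact: a_neq0 | | exact: chi_i].
  by apply/free_of_scale/free_of_gen; rewrite eq_sym.
exact: (tame_comp (tame_id (phi := id) (fun=> erefl)) chi_el (fun=> erefl)).
Qed.

(** If the pivot vanishes, add the second row to the first; the new pivot is
    nonzero because [phi] is injective. *)
Lemma linear_tame phi i j : brace_automorphism phi -> i != j ->
  (forall k, (dg (phi (g k)) <= 1)%N) -> tame phi.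
Proof.
move=> aut_phi ij phi1.
have [a0|] := eqVneq ((phi (g i))@_(BWord i [::])) 0; last exact: linear_tame_diag ij _.
have j_free : free_of i (g j) by apply: free_of_gen; rewrite eq_sym.
have lin_phi := aut_phi.1.1.
apply: (tame_elem (oner_neq0 F) j_free).
have phi_i : (phi \o elem i 1 (g j)) (g i) = phi (g i) + phi (g j).
  by rewrite /= elem_gen (linD lin_phi) scale1r.
apply: (linear_tame_diag _ ij) => [|k|].
- by apply: automorphism_elem => //; apply: oner_neq0.
- have [->|ki] := eqVneq k i; first by rewrite phi_i; apply: dg_add; apply: phi1.
  by rewrite /= (elem_gen_neq _ _ ki); apply: phi1.
apply/eqP => sum0; have c0 : (phi (g j))@_(BWord i [::]) = 0.
  rewrite -[LHS]add0r -[X in X + _]a0 -mcoeffD; by rewrite phi_i in sum0.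
pose b k := (phi (g k))@_(BWord j [::]).
have phi_b k : phi (g k) = b k *: g j.
  rewrite {1}(linear_form ij (phi1 k)).
  have -> : (phi (g k))@_(BWord i [::]) = 0.
    have [->|ki] := eqVneq k i; first exact: a0.
    by rewrite (ord2_cases ij ki); exact: c0.
  by rewrite scale0r; apply: add0r.
have b_neq0 : b i != 0.
  have := automorphism_neq0 aut_phi (gen_neq0 i); rewrite phi_b.
  by apply: contra => /eqP ->; rewrite scale0r.
have v_neq0 : b j *: g i - b i *: g j != 0.
  apply: contra b_neq0; rewrite subr_eq0 => /eqP bij; apply/eqP.
  transitivity ((b i *: g j)@_(BWord j [::])); first by rewrite mcoeff_letter eqxx.
  by rewrite -bij mcoeff_letter (negbTE ij).
case/eqP: (automorphism_neq0 aut_phi v_neq0).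
have comm (v : B) (c d : F) : c *: (d *: v) - d *: (c *: v) = 0.
  by rewrite !scalerA mulrC subrr.
rewrite (linB lin_phi) -[RHS](comm (g j) (b j) (b i)).
congr (_ - _).
  transitivity (b j *: phi (g i)); first exact: linZ.
  congr (_ *: _); exact: phi_b.
transitivity (b i *: phi (g j)); first exact: linZ.
congr (_ *: _); exact: phi_b.
Qed.

Lemma tame_of_degree n phi i j : [pchar F] =i pred0 ->
  brace_automorphism phi -> i != j ->
  (dg (phi (g i)) + dg (phi (g j)) <= n)%N -> tame phi.
Proof.
move=> charF0; elim: n phi i j => [|n IH] phi i j aut_phi ij le_n.
  have := dg_gt0 (automorphism_neq0 aut_phi (gen_neq0 i)).
  by move: le_n; lia.
wlog le_ij : i j ij le_n / (dg (phi (g i)) <= dg (phi (g j)))%N.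
  move=> wl; case/orP: (leq_total (dg (phi (g i))) (dg (phi (g j)))); first exact: wl.
  by apply: wl; rewrite 1?eq_sym 1?addnC.
have [j_le1|j_gt1] := leqP (dg (phi (g j))) 1.
  apply: (linear_tame aut_phi ij) => k.
  have [->|ki] := eqVneq k i; first exact: leq_trans le_ij j_le1.
  by rewrite (ord2_cases ij ki).
have [h h_free h_lt] := degree_reduction charF0 aut_phi ij le_ij j_gt1.
have nh_free : free_of j (- h) by move=> w; rewrite msuppN => /h_free.
apply: (tame_elem (oner_neq0 F) nh_free).
apply: (IH _ i j) => //.
  by apply: automorphism_elem => //; apply: oner_neq0.
have lin_phi := aut_phi.1.1.
have bound : (dg (phi (g i)) + dg (phi (g j) - phi h)%R <= n)%N.
  by rewrite -ltnS; apply: leq_trans le_n; rewrite ltn_add2l.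
apply: leq_trans bound; apply: leq_add; apply: eq_leq; congr dg => /=.
  by rewrite (elem_gen_neq _ _ ij).
by rewrite elem_gen scale1r (linB lin_phi).
Qed.

End TwoGenerators.

Theorem theorem4p4 (F : fieldType) (charF0 : [pchar F] =i pred0)
  (phi : Br F 2 -> Br F 2) :
  brace_automorphism phi -> tame phi.
Proof.
move=> aut_phi; exact: (tame_of_degree charF0 aut_phi (i := ord0) (j := ord_max)).
Qed.
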